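(* Let $\mathcal{M}$ be a Riemannian manifold, $g\colon\mathcal{M}\to\mathbb{R}$ twice continuously differentiable, and let $(y_k)_{k\geq0}$ be a sequence generated by the hooked Riemannian trust-region algorithm (described in the context) with hook $\Phi\colon\mathcal{M}\to\mathcal{M}$ and parameters $\gamma_c,\eta,\underline\gamma,\overline\gamma$. Let $$K(\epsilon_1,\epsilon_2)=\left|\{k:\|\nabla g(y_k)\|>\epsilon_1\text{ or }|(\lambda_k)_-|>\epsilon_2\}\right|.$$ Assume: (A1) $g(\Phi(y))\leq g(y)$ for all $y\in\mathcal{M}$; (A2) there exist $L_1,L_2\geq0$ such that, for all $(y_k,s_k)$ generated by the algorithm, with $\hat g_k=g\circ\mathrm{R}_{y_k}$, we have $\|\nabla^2\hat g_k(0)\|\leq L_1$ (operator norm) and $$\left|g(\mathrm{R}_{y_k}(s_k))-g(y_k)-\langle s_k,\nabla g(y_k)\rangle\right|\leq\tfrac{L_1}{2}\|s_k\|^2,$$ $$\left|g(\mathrm{R}_{y_k}(s_k))-g(y_k)-\langle s_k,\nabla g(y_k)\rangle-\tfrac12\langle s_k,\nabla^2\hat g_k(0)[s_k]\rangle\right|\leq\tfrac{L_2}{6}\|s_k\|^3;$$ (A3) there exists $g_{\min}\in\mathbb{R}$ such that $g(y_k)\geq g_{\min}$ for all $k$. Then for all $\epsilon_1,\epsilon_2>0$: $$K(\epsilon_1,\epsilon_2)\leq\left\lceil\log_{\gamma_c}\!\left(\frac{\gamma_{\min}}{\overline\gamma}\right)+1\right\rceil\left\lfloor\frac{g(y_0)-g_{\min}}{\kappa_{\min}}\max\!\left(\frac{1}{\epsilon_1^2},\frac{1}{\epsilon_2^3}\right)\right\rfloor,$$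 where $$\gamma_{\min}=\min\!\left(\underline\gamma,\frac{\gamma_c}{1+L_1},\frac{\gamma_c(1-\eta)}{2L_1},\frac{3\gamma_c(1-\eta)}{L_2}\right)\in(0,1),\qquad\kappa_{\min}=\tfrac12\eta\gamma_{\min}^2.$$ Moreover, all accumulation points of $(y_k)_{k\geq0}$ (if any) are 2-critical points of $\min_{y\in\mathcal{M}}g(y)$.
   Context: A point $y\in\mathcal{M}$ is 2-critical for $g$ if for all smooth curves $c\colon\mathbb{R}\to\mathcal{M}$ with $c(0)=y$ one has $(g\circ c)'(0)=0$ and $(g\circ c)''(0)\geq0$; equivalently, the Riemannian gradient $\nabla g(y)$ is zero and the Riemannian Hessian $\nabla^2g(y)$ is positive semidefinite. Algorithm. A retraction $\mathrm{R}\colon\mathrm{T}\mathcal{M}\to\mathcal{M}$ is fixed: a smooth map such that $c(t)=\mathrm{R}_y(tu)$ satisfies $c(0)=y$, $c'(0)=u$. Parameters: $\gamma_c,\eta\in(0,1)$, $0<\underline{\gamma}\leq\overline{\gamma}<\infty$. Input: $y_0\in\mathcal{M}$, $\gamma_0\in[\underline\gamma,\overline\gamma]$. First replace $y_0$ by $\Phi(y_0)$ (so $y_0$ in the generated sequence is the hooked point). At iteration $k=0,1,2,\dots$: let $\hat g_k=g\circ\mathrm{R}_{y_k}\colon\mathrm{T}_{y_k}\mathcal{M}\to\mathbb{R}$, let $m_k(s)=g(y_k)+\langle s,\nabla\hat g_k(0)\rangle+\frac12\langle s,\nabla^2\hat g_k(0)[s]\rangle$ (note $\nabla\hat g_k(0)=\nabla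 g(y_k)$), let $\lambda_k$ be the least eigenvalue of $\nabla^2\hat g_k(0)$ and $(\lambda_k)_-=\min(\lambda_k,0)$. (i) If $\lambda_k<0$ and $\|\nabla g(y_k)\|^2<|(\lambda_k)_-|^3$, set $\delta_k=\gamma_k|(\lambda_k)_-|$ and $u_k=e_k$, where $e_k$ is a unit-norm eigenvector of $\nabla^2\hat g_k(0)$ for $\lambda_k$ with sign such that $\langle e_k,\nabla g(y_k)\rangle\leq0$; otherwise set $\delta_k=\gamma_k\|\nabla g(y_k)\|$ and $u_k=-\nabla g(y_k)$. (ii) Let $s_k^c=t_ku_k$ with $t_k$ a minimizer of $m_k(tu_k)$ over $t\geq0$ subject to $\|tu_k\|\leq\delta_k$. Choose any $s_k\in\mathrm{T}_{y_k}\mathcal{M}$ with $\|s_k\|\leq\delta_k$ and $m_k(s_k)\leq m_k(s_k^c)$. (iii) Let $\rho_k=\frac{g(y_k)-g(\mathrm{R}_{y_k}(s_k))}{m_k(0)-m_k(s_k)}$ (set $\rho_k=1$ if the denominator is zero). (iv) If $\rho_k\geq\eta$, set $y_{k+1}=\Phi(\mathrm{R}_{y_k}(s_k))$ and choose any $\gamma_{k+1}\in[\underline\gamma,\overline\gamma]$; otherwise set $y_{k+1}=y_k$ and $\gamma_{k+1}=\gamma_c\gamma_k$. In the definition of $\gamma_{\min}$, a fraction whose denominator $L_1$ or $L_2$ is zero is read as $+\infty$. *)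

(* Defs.v *)
From HB Require Import structures.
From mathcomp Require Import all_boot all_order all_algebra.
From mathcomp Require Import all_classical all_reals all_analysis.

Set Implicit Arguments.
Unset Strict Implicit.
Unset Printing Implicit Defensive.

Import Order.TTheory GRing.Theory Num.Theory.
Import numFieldNormedType.Exports.

Local Open Scope classical_set_scope.
Local Open Scope ring_scope.

(* C^k and C^oo maps on an open subset of a finite-dimensional normed space:
   all iterated directional derivatives of order at most k exist and are
   continuous. *)
Fixpoint Ck_on (R : realType) (V W : normedModType R) (k : nat)
    (U : set V) (f : V -> W) : Prop :=
  match k with
  | 0%N => forall x, U x -> {for x, continuous f}
  | k'.+1 => (forall x, U x -> differentiable f x) /\
             (forall v : V, Ck_on k' U ('D_v f))
  end.

Definition smooth_on (R : realType) (V W : normedModType R)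
    (U : set V) (f : V -> W) : Prop :=
  forall k, Ck_on k U f.

Record chart (R : realType) (n : nat) (M : topologicalType) := Chart {
  cdom : set M;
  cimg : set 'rV[R]_n;
  cphi : M -> 'rV[R]_n;
  cpsi : 'rV[R]_n -> M;
  cdom_open : open cdom;
  cimg_open : open cimg;
  cphi_img : forall y, cdom y -> cimg (cphi y);
  cpsi_dom : forall x, cimg x -> cdom (cpsi x);
  cphiK : forall y, cdom y -> cpsi (cphi y) = y;
  cpsiK : forall x, cimg x -> cphi (cpsi x) = x;
  cphi_continuous : forall y, cdom y -> {for y, continuous cphi};
  cpsi_continuous : forall x, cimg x -> {for x, continuous cpsi}
}.

(* A map f from an open subset U of a normed space to M is smooth when, for
   every chart d, the set of points of U sent to the domain of d is open and f
   read in d is smooth there. *)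
Definition smooth_into (R : realType) (n : nat) (M : topologicalType)
    (atlas : set (chart R n M)) (V : normedModType R)
    (U : set V) (f : V -> M) : Prop :=
  forall d, atlas d ->
    open (U `&` f @^-1` cdom d) /\
    smooth_on (U `&` f @^-1` cdom d) (cphi d \o f).

(* Tangent vectors are encoded by their coordinates: a chart [chart_at y] around
   each point y is part of the data, and T_y M is 'rV[R]_n, a row vector u
   standing for the tangent vector whose coordinates in [chart_at y] are u.
   (The choice of these charts is arbitrary, in particular it need not depend
   continuously on y: the coordinates of a tangent vector in any other chart
   are obtained through the differential of the transition map.) *)
Record smooth_manifold (R : realType) (n : nat) := SmoothManifold {
  mcarrier :> topologicalType;
  atlas : set (chart R n mcarrier);
  chart_at : mcarrier -> chart R n mcarrier;
  manifold_hausdorff : hausdorff_space mcarrier;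
  manifold_second_countable : @second_countable mcarrier;
  chart_at_atlas : forall y, atlas (chart_at y);
  chart_at_dom : forall y, cdom (chart_at y) y;
  atlas_compatible :
    forall c, atlas c -> smooth_into atlas (cimg c) (cpsi c)
}.

(* The element of T_y M whose coordinates in the chart c are w. *)
Definition tangent_of (R : realType) (n : nat) (M : smooth_manifold R n)
    (c : chart R n M) (y : M) (w : 'rV[R]_n) : 'rV[R]_n :=
  'd (cphi (chart_at y) \o cpsi c) (cphi c y) w.

(* The velocity c'(t), an element of T_(c t) M. *)
Definition velocity (R : realType) (n : nat) (M : smooth_manifold R n)
    (c : R -> M) (t : R) : 'rV[R]_n :=
  derive1 (cphi (chart_at (c t)) \o c) t.

Record riemannian_manifold (R : realType) (n : nat) := RiemannianManifold {
  rmanifold :> smooth_manifold R n;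
  metric : rmanifold -> 'rV[R]_n -> 'rV[R]_n -> R;
  metric_sym : forall y u v, metric y u v = metric y v u;
  metric_linear : forall y a u v w,
    metric y (a *: u + v) w = a * metric y u w + metric y v w;
  metric_posdef : forall y u, u != 0 -> 0 < metric y u u;
  metric_smooth : forall c, atlas c -> forall v w,
    smooth_on (cimg c) (fun x => metric (cpsi c x)
      (tangent_of c (cpsi c x) v) (tangent_of c (cpsi c x) w) : R)
}.

Definition rnorm (R : realType) (n : nat) (M : riemannian_manifold R n)
    (y : M) (v : 'rV[R]_n) : R :=
  Num.sqrt (metric y v v).

Definition C2_function (R : realType) (n : nat) (M : smooth_manifold R n)
    (g : M -> R) : Prop :=
  forall c, atlas c -> Ck_on 2 (cimg c) (g \o cpsi c : 'rV[R]_n -> R).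

(* Gradient and Hessian of a function f on a space of coordinates for T_y M,
   with respect to the (constant) inner product <.,.>_y.  The vector selected
   by xget is unique, and it exists for every f; for f twice differentiable,
   the Hessian is the differential of the gradient. *)
Definition gradT (R : realType) (n : nat) (M : riemannian_manifold R n)
    (y : M) (f : 'rV[R]_n -> R) (s : 'rV[R]_n) : 'rV[R]_n :=
  xget 0 [set w | forall v, metric y w v = 'd f s v].

Definition hessT (R : realType) (n : nat) (M : riemannian_manifold R n)
    (y : M) (f : 'rV[R]_n -> R) (s v : 'rV[R]_n) : 'rV[R]_n :=
  'D_v (gradT y f) s.

(* Riemannian gradient: <grad g y, v>_y = Dg(y)[v] for all v in T_y M. *)
Definition grad (R : realType) (n : nat) (M : riemannian_manifold R n)
    (g : M -> R) (y : M) : 'rV[R]_n :=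
  gradT y (g \o cpsi (chart_at y)) (cphi (chart_at y) y).

Definition smooth_curve (R : realType) (n : nat) (M : smooth_manifold R n)
    (c : R -> M) : Prop :=
  smooth_into (@atlas R n M) [set: R] c.

Definition two_critical (R : realType) (n : nat) (M : smooth_manifold R n)
    (g : M -> R) (y : M) : Prop :=
  forall c : R -> M, smooth_curve c -> c 0 = y ->
    derive1 (g \o c) 0 = 0 /\ 0 <= derive1n 2 (g \o c) 0.

(* Smoothness of Rt : TM -> M is expressed in the charts of TM induced by the
   charts of M. *)
Record retraction (R : realType) (n : nat) (M : smooth_manifold R n)
    (Rt : M -> 'rV[R]_n -> M) : Prop := Retraction {
  retraction_smooth : forall c, atlas c ->
    smooth_into (@atlas R n M) [set p : 'rV[R]_n * 'rV[R]_n | cimg c p.1]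
      (fun p => Rt (cpsi c p.1) (tangent_of c (cpsi c p.1) p.2));
  retraction0 : forall y, Rt y 0 = y;
  retraction_velocity : forall y u,
    velocity (fun t => Rt y (t *: u)) 0 = u
}.

Definition eigenvector (R : realType) (n : nat)
    (H : 'rV[R]_n -> 'rV[R]_n) (a : R) (v : 'rV[R]_n) : Prop :=
  v != 0 /\ H v = a *: v.

Definition least_eigenvalue (R : realType) (n : nat)
    (H : 'rV[R]_n -> 'rV[R]_n) (a : R) : Prop :=
  (exists v, eigenvector H a v) /\
  (forall b v, eigenvector H b v -> a <= b).

Definition opnorm (R : realType) (n : nat) (M : riemannian_manifold R n)
    (y : M) (H : 'rV[R]_n -> 'rV[R]_n) : \bar R :=
  ereal_sup [set (rnorm y (H v))%:E | v in [set v | rnorm y v <= 1]].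

(* (a)_- in the convention where it is nonpositive. *)
Definition negpart (R : realType) (a : R) : R := Num.min a 0.

Section Algorithm.
Variables (R : realType) (n : nat) (M : riemannian_manifold R n).
Variables (Rt : M -> 'rV[R]_n -> M) (g : M -> R).

Definition pullback (y : M) : 'rV[R]_n -> R := g \o Rt y.

Definition hess_pullback (y : M) : 'rV[R]_n -> 'rV[R]_n :=
  hessT y (pullback y) 0.

Definition model (y : M) (s : 'rV[R]_n) : R :=
  g y + metric y s (gradT y (pullback y) 0)
      + 2^-1 * metric y s (hess_pullback y s).

Definition rho (y : M) (s : 'rV[R]_n) : R :=
  let den := model y 0 - model y s in
  if den == 0 then 1 else (g y - g (Rt y s)) / den.

(* The selection of the radius delta and of the direction u at the point y,
   with gam the current radius parameter and lam the least eigenvalue of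
   the Hessian of the pullback. *)
Definition radius_direction (y : M) (gam lam delta : R) (u : 'rV[R]_n) : Prop :=
  if (lam < 0) && (rnorm y (grad g y) ^+ 2 < `|negpart lam| ^+ 3) then
    [/\ delta = gam * `|negpart lam|,
        eigenvector (hess_pullback y) lam u, rnorm y u = 1
      & metric y u (grad g y) <= 0]
  else
    delta = gam * rnorm y (grad g y) /\ u = - grad g y.

Definition cauchy_step (y : M) (delta : R) (u : 'rV[R]_n) (t : R) : Prop :=
  [/\ 0 <= t, rnorm y (t *: u) <= delta
    & forall t', 0 <= t' -> rnorm y (t' *: u) <= delta ->
        model y (t *: u) <= model y (t' *: u)].

(* The sequences generated by the hooked trust-region algorithm with hook Phi
   from the input yin and gam 0. *)
Record htr_run (Phi : M -> M) (gamc eta gamlo gamhi : R) (yin : M)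
    (y : nat -> M) (gam lam delta t : nat -> R) (u s : nat -> 'rV[R]_n) :
    Prop := HtrRun {
  htr_y0 : y 0%N = Phi yin;
  htr_gam0 : gamlo <= gam 0%N <= gamhi;
  htr_lam : forall k, least_eigenvalue (hess_pullback (y k)) (lam k);
  htr_radius_direction : forall k,
    radius_direction (y k) (gam k) (lam k) (delta k) (u k);
  htr_cauchy : forall k, cauchy_step (y k) (delta k) (u k) (t k);
  htr_step : forall k, rnorm (y k) (s k) <= delta k /\
    model (y k) (s k) <= model (y k) (t k *: u k);
  htr_update : forall k,
    if eta <= rho (y k) (s k) then
      y k.+1 = Phi (Rt (y k) (s k)) /\ gamlo <= gam k.+1 <= gamhi
    else y k.+1 = y k /\ gam k.+1 = gamc * gam k
}.

Definition K_set (y : nat -> M) (lam : nat -> R) (eps1 eps2 : R) : set nat :=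
  [set k | eps1 < rnorm (y k) (grad g (y k)) \/ eps2 < `|negpart (lam k)|].

End Algorithm.

Definition logb (R : realType) (b x : R) : R := ln x / ln b.

Definition frac_or_infty (R : realType) (a b : R) : \bar R :=
  if b == 0 then +oo%E else (a / b)%:E.

(* The minimum is taken in the extended reals and is finite. *)
Definition gamma_min (R : realType) (gamc eta gamlo L1 L2 : R) : R :=
  fine (mine (mine (gamlo%:E) ((gamc / (1 + L1))%:E))
             (mine (frac_or_infty (gamc * (1 - eta)) (2 * L1))
                   (frac_or_infty (3 * gamc * (1 - eta)) L2)))%E.

Definition kappa_min (R : realType) (gamc eta gamlo L1 L2 : R) : R :=
  2^-1 * eta * gamma_min gamc eta gamlo L1 L2 ^+ 2.

(* Main.v *)
(** Proof idea.  If the radius parameter gam_k is below a constant times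
    1/L1 and 1/L2, the model is accurate enough for step k to be accepted, so
    gam_k never falls below gamma_min.  Hence an accepted step decreases g by
    at least kappa_min * max(|grad g|^2, |lambda_-|^3), which bounds the number
    of accepted steps outside the (eps1, eps2)-critical region, while two
    accepted steps are separated by boundedly many rejected ones, during which
    gam shrinks from at most gamhi by the factor gamc and the iterate stays
    fixed.

    Consequently the gradients tend to 0 and the least eigenvalues become
    asymptotically nonnegative.  Expressed in a single chart around an
    accumulation point, the first two derivatives of the pullback
    (x, w) |-> g (Rt x w) along the fibre are continuous in x, so both
    conditions pass to the limit; the Rayleigh quotient replaces the eigenvalue.
    Since the gradient vanishes at the limit, second derivatives of g along
    curves depend on the velocity only and agree with those of the pullback. *)

Require Import Defs.
From mathcomp Require Import all_boot all_order all_algebra finmap.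
From mathcomp Require Import all_classical all_reals all_analysis.
From mathcomp Require Import ring lra zify.
Import Order.TTheory GRing.Theory Num.Theory.
Import numFieldNormedType.Exports.
Local Open Scope classical_set_scope.
Local Open Scope ring_scope.

Set Implicit Arguments.
Unset Strict Implicit.
Unset Printing Implicit Defensive.

(** * Functions of class C^k *)

(** With zero as candidate differential the remainder vanishes near [x], hence is little-o;
    [diff_unique] then identifies the candidate with ['d e x]. *)
Lemma near0_differentiable (R : realType) (V W : normedModType R) (e : V -> W)
    (x : V) : (\near x, e x = 0) -> differentiable e x.
Proof.
move=> e0; pose d : {linear V -> W} := 'd (cst (0 : W)) x.
have d0 : d = 0 :> (V -> W) by rewrite /d diff_cst.
have cd : continuous d by rewrite d0; exact: cst_continuous.
have E : e \o shift x = cst (e x) + d +o_0 id.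
  apply/eqaddoP => eps eps0; near=> h.
  rewrite d0 /= !fctE /= (nbhs_singleton e0) add0r subr0.
  suff -> : e (h + x) = 0 by rewrite normr0 mulr_ge0// ltW.
  by near: h; move: e0; rewrite (near_shift 0 x) /= subr0; apply: filterS => z.
apply/diff_locallyP; have dE := diff_unique cd E.
by rewrite dE; split.
Unshelve. all: by end_near. Qed.

(** Write [g] as the sum of [g - f], which vanishes near [x], and [f]. *)
Lemma near_eq_differentiable (R : realType) (V W : normedModType R)
    (f g : V -> W) (x : V) :
  (\near x, f x = g x) -> differentiable f x -> differentiable g x.
Proof.
move=> fg df; rewrite -[g](subrK f); apply: differentiableD => //.
by apply: near0_differentiable; apply: filterS fg => z /= E; rewrite !fctE E subrr.
Qed.

Lemma Ck_on_ext (R : realType) (V W : normedModType R) (k : nat) (U : set V)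
    (f g : V -> W) : open U -> (forall x, U x -> f x = g x) ->
  Ck_on k U f -> Ck_on k U g.
Proof.
move=> oU; elim: k f g => [|k IH] f g fg /=.
  move=> cf x Ux; have Un : \near x, f x = g x.
    by near=> z; apply: fg; near: z; exact: open_nbhs_nbhs.
  rewrite /prop_for /continuous_at -(fg _ Ux); apply: cvg_trans (cf x Ux).
  by apply: near_eq_cvg.
have fgn x : U x -> \near x, f x = g x.
  by move=> Ux; near=> z; apply: fg; near: z; exact: open_nbhs_nbhs.
case=> df Cf; split=> [x Ux|v];
  first exact: near_eq_differentiable (fgn x Ux) (df x Ux).
by apply: IH (Cf v) => x Ux; apply: near_eq_derive; exact: fgn.
Unshelve. all: by end_near. Qed.

Lemma Ck_onS (R : realType) (V W : normedModType R) (k : nat) (U : set V)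
    (f : V -> W) : Ck_on k.+1 U f -> Ck_on k U f.
Proof.
elim: k f => [|k IH] f; first by case=> df _ x Ux;
  exact: differentiable_continuous (df x Ux).
by case=> df Cf; split=> // v; apply: IH; exact: Cf.
Qed.

Lemma Ck_on_cst (R : realType) (V W : normedModType R) (k : nat) (U : set V)
    (c : W) : Ck_on k U (cst c : V -> W).
Proof.
elim: k c => [|k IH] c; first by move=> x _; exact: cst_continuous.
split=> [x _|v]; first exact: differentiable_cst.
by have -> : 'D_v (cst c : V -> W) = cst 0 by rewrite funeqE => x; rewrite derive_cst.
Qed.

Lemma Ck_onD (R : realType) (V W : normedModType R) (k : nat) (U : set V)
    (f g : V -> W) : open U -> Ck_on k U f -> Ck_on k U g ->
  Ck_on k U (fun x => f x + g x).
Proof.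
move=> oU; elim: k f g => [|k IH] f g /=.
  by move=> cf cg x Ux; apply: continuousD; [exact: cf|exact: cg].
move=> [df Cf] [dg Cg]; split=> [x Ux|v].
  by apply: differentiableD; [exact: df|exact: dg].
apply: Ck_on_ext (IH _ _ (Cf v) (Cg v)) => // x Ux.
by rewrite deriveD//; apply: diff_derivable; [exact: df|exact: dg].
Qed.

Lemma Ck_on_sum (R : realType) (V W : normedModType R) (k n : nat) (U : set V)
    (f : 'I_n -> V -> W) : open U -> (forall i, Ck_on k U (f i)) ->
  Ck_on k U (fun x => \sum_i f i x).
Proof.
move=> oU Cf; elim: n f Cf => [|n IH] f Cf.
  by under eq_fun do rewrite big_ord0; exact: Ck_on_cst.
under eq_fun do rewrite big_ord_recr/=.
by apply: Ck_onD => //; exact: IH.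
Qed.

Lemma Ck_onM (R : realType) (V : normedModType R) (k : nat) (U : set V)
    (f g : V -> R) : open U -> Ck_on k U f -> Ck_on k U g ->
  Ck_on k U (fun x => f x * g x).
Proof.
move=> oU; elim: k f g => [|k IH] f g.
  by move=> cf cg x Ux; apply: continuousM; [exact: cf|exact: cg].
move=> Cf' Cg'; have := Ck_onS Cf'; have := Ck_onS Cg'.
move: Cf' Cg' => [df Cf] [dg Cg] Cg0 Cf0; split=> [x Ux|v].
  by apply: differentiableM; [exact: df|exact: dg].
apply: Ck_on_ext (Ck_onD oU (IH _ _ Cf0 (Cg v)) (IH _ _ Cg0 (Cf v))) => // x Ux.
by rewrite deriveM//; apply: diff_derivable; [exact: df|exact: dg].
Qed.

Lemma derive_coord (R : realType) (V : normedModType R) (m n : nat)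
    (F : V -> 'M[R]_(m, n)) (x v : V) i j : derivable F x v ->
  'D_v (fun z => F z i j) x = ('D_v F x) i j.
Proof. by move=> dF; rewrite derive_mx// mxE. Qed.

Lemma Ck_on_coord (R : realType) (V : normedModType R) (k n : nat) (U : set V)
    (F : V -> 'rV[R]_n) i : open U -> Ck_on k U F ->
  Ck_on k U (fun x => F x 0 i).
Proof.
move=> oU; elim: k F => [|k IH] F /=.
  move=> cF x Ux; apply: (@continuous_comp _ _ _ F (fun N : 'rV[R]_n => N 0 i)).
    exact: cF.
  exact: coord_continuous.
move=> [dF CF]; split=> [x Ux|v].
  apply: (@differentiable_comp _ _ _ _ F (fun N : 'rV[R]_n => N 0 i)).
    exact: dF.
  exact: differentiable_coord.
apply: Ck_on_ext (IH _ (CF v)) => // x Ux.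
by rewrite derive_coord//; exact: diff_derivable (dF x Ux).
Qed.

Lemma derive_sum_coord (R : realType) (n : nat) (h : 'rV[R]_n -> R)
    (x v : 'rV[R]_n) : differentiable h x ->
  'D_v h x = \sum_i v 0 i * 'D_(delta_mx 0 i) h x.
Proof.
move=> dh; rewrite deriveE// {1}(row_sum_delta v) linear_sum/=.
by apply: eq_bigr => i _; rewrite linearZ/= deriveE.
Qed.

Lemma derive_chain (R : realType) (V : normedModType R) (n : nat)
    (F : V -> 'rV[R]_n) (h : 'rV[R]_n -> R) (x v : V) :
  differentiable F x -> differentiable h (F x) ->
  'D_v (h \o F) x = \sum_i ('D_v F x) 0 i * 'D_(delta_mx 0 i) h (F x).
Proof.
move=> dF dh; rewrite deriveE; last exact: differentiable_comp.
by rewrite diff_comp//= -!deriveE// derive_sum_coord.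
Qed.

(** In coordinates the chain rule makes each directional derivative of [h \o F] a finite sum of
    products of a component of ['D_v F] and a partial derivative of [h] composed with [F], so the
    induction runs over [h] with [F] fixed. *)
Lemma Ck_on_comp (R : realType) (V : normedModType R) (k n : nat)
    (U : set V) (U' : set 'rV[R]_n) (F : V -> 'rV[R]_n) (h : 'rV[R]_n -> R) :
  open U -> (forall x, U x -> U' (F x)) -> Ck_on k U F -> Ck_on k U' h ->
  Ck_on k U (h \o F).
Proof.
move=> oU UU'; elim: k h => [|k IH] h.
  by move=> cF ch x Ux; apply: continuous_comp; [exact: cF|exact: ch (UU' _ Ux)].
move=> CF' [dh Ch]; have CF0 := Ck_onS CF'; case: CF' => dF CF; split=> [x Ux|v].
  by apply: differentiable_comp; [exact: dF|exact/dh/UU'].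
apply: (@Ck_on_ext _ _ _ _ _ (fun x => \sum_i ('D_v F x) 0 i * ('D_(delta_mx 0 i) h
  \o F) x)) => //.
  by move=> x Ux; rewrite derive_chain//; [exact: dF|exact/dh/UU'].
apply: Ck_on_sum => // i; apply: Ck_onM => //;
  last exact: (IH ('D_(delta_mx 0 i) h)) CF0 (Ch _).
by apply: (@Ck_on_coord _ _ _ _ _ ('D_v F)) => //; exact: CF.
Qed.

Lemma derive_slice (R : realType) (V1 V2 W : normedModType R)
    (f : V1 * V2 -> W) (a : V1) (x v : V2) :
  'D_v (fun w => f (a, w)) x = 'D_(0, v) f (a, x).
Proof.
rewrite /derive; set p := (X in lim (X @ _) = _); set q := (X in _ = lim (X @ _)).
suff -> : p = q by []; rewrite funeqE => h; rewrite /p /q /=.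
by congr (_ *: (f _ - _)); congr pair; rewrite /= scaler0 add0r.
Qed.

Lemma Ck_on_slice (R : realType) (V1 V2 W : normedModType R) (k : nat)
    (U : set (V1 * V2)) (f : V1 * V2 -> W) (a : V1) :
  Ck_on k U f -> Ck_on k [set w | U (a, w)] (fun w => f (a, w)).
Proof.
have dp (x : V2) : differentiable (fun w : V2 => (a, w)) x by exact:
  differentiable_pair.
elim: k f => [|k IH] f /=.
  move=> cf x Ux; apply: (@continuous_comp _ _ _ (fun w => (a, w)) f); last exact: cf.
  exact: differentiable_continuous.
case=> df Cf; split=> [x Ux|v].
  by apply: (@differentiable_comp _ _ _ _ (fun w => (a, w)) f) => //; exact: df.
have -> : 'D_v (fun w => f (a, w)) = fun w => ('D_(0, v) f) (a, w).
  by rewrite funeqE => x; exact: derive_slice.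
exact: (IH ('D_(0, v) f) (Cf _)).
Qed.

(** * Mean value theorem and symmetry of second derivatives *)

Lemma MVT_line (R : realType) (V : normedModType R) (f : V -> R) (x v : V) (h : R) :
  0 < h -> (forall t, 0 <= t <= h -> differentiable f (x + t *: v)) ->
  exists2 t, 0 < t < h & f (x + h *: v) - f x = h * 'D_v f (x + t *: v).
Proof.
move=> h0 df; pose l := fun t : R => x + t *: v.
have dZ t : differentiable (fun t : R => t *: v) t by exact: (@differentiableZl _ _ _
  id).
have dl t : differentiable l t by exact: differentiableD.
have l1 t : 'd l t 1 = v.
  have did : 'd id t = id :> (R -> R) by exact: diff_val.
  by rewrite diffD// diff_cst (@diffZl _ _ _ id)// did /= add0r scale1r.
have dfl t : 0 <= t <= h -> is_derive t 1 (f \o l) ('D_v f (l t)).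
  move=> th; have dft := df t th.
  have dc : differentiable (f \o l) t by exact: differentiable_comp.
  apply: DeriveDef; first exact: diff_derivable.
  by rewrite !deriveE// diff_comp//= l1.
have [||t] := @MVT R (f \o l) (fun t => 'D_v f (l t)) 0 h h0.
- by move=> t; rewrite in_itv/= => /andP[t0 th]; apply: dfl; rewrite !ltW.
- apply: derivable_within_continuous => t; rewrite in_itv/= => th.
  by have [] := dfl _ th.
rewrite in_itv/= /l scale0r addr0 subr0 => th E; exists t => //.
by rewrite mulrC -E.
Qed.

(** Apply the mean value theorem twice: to [f (z + h *: w) - f z] in the direction [v], then to
    ['D_v f] in the direction [w]. *)
Lemma second_difference (R : realType) (V : normedModType R) (U : set V)
    (f : V -> R) (x v w : V) (h : R) : 0 < h -> Ck_on 2 U f ->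
    (forall s t, 0 <= s <= h -> 0 <= t <= h -> U (x + s *: v + t *: w)) ->
  exists s t, [/\ 0 < s < h, 0 < t < h &
    f (x + h *: v + h *: w) - f (x + h *: v) - (f (x + h *: w) - f x) =
    h ^+ 2 * 'D_w ('D_v f) (x + s *: v + t *: w)].
Proof.
move=> h0 [df Cf] Ust; have [dDf _] := Cf v.
have h00 : 0 <= (0 : R) <= h by rewrite lexx ltW.
have hh : 0 <= h <= h by rewrite lexx ltW.
have U1 t : 0 <= t <= h -> U (x + t *: v + h *: w) by move=> ht; exact: Ust.
have U0 t : 0 <= t <= h -> U (x + t *: v).
  by move=> ht; rewrite -[_ + _]addr0 -(scale0r w); exact: Ust.
pose f' z := f (z + h *: w) - f z.
have dsh z : U (z + h *: w) -> differentiable (fun z => f (z + h *: w)) z.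
  by move=> Uz; apply: (@differentiable_comp _ _ _ _ (fun z => z + h *: w) f) => //;
    exact: df.
have Dsh z : 'D_v (fun z => f (z + h *: w)) z = 'D_v f (z + h *: w).
  rewrite /derive; set p := (X in lim (X @ _) = _); set q := (X in _ = lim (X @ _)).
  by suff -> : p = q by []; rewrite funeqE => k; rewrite /p /q /= addrA.
have [|s hs Es] := @MVT_line R V f' x v h h0.
  move=> t ht; apply: differentiableB; first by apply: dsh; exact: U1.
  by apply: df; exact: U0.
have hs' : 0 <= s <= h by case/andP: hs => *; rewrite !ltW.
have [|t ht Et] := @MVT_line R V ('D_v f) (x + s *: v) w h h0.
  by move=> t ht; apply: dDf; exact: Ust.
exists s, t; split => //; rewrite -[LHS]/(f' _ - f' _) Es expr2 -mulrA -Et.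
rewrite deriveB ?Dsh//; apply: diff_derivable; first by apply: dsh; exact: U1.
by apply: df; exact: U0.
Qed.

(** Schwarz's theorem. The second difference is symmetric in [v] and [w], so the two mixed
    derivatives take a common value at two points of a small parallelogram; by continuity that value
    is within [e] of both [A] and [B], which is absurd for [e] half their distance. *)
Lemma derive_comm (R : realType) (V : normedModType R) (U : set V)
    (f : V -> R) (x v w : V) : open U -> U x -> Ck_on 2 U f ->
  'D_w ('D_v f) x = 'D_v ('D_w f) x.
Proof.
move=> oU Ux C2; have [_ /(_ v)[_ /(_ w) cwv]] := C2;
  have [_ /(_ w)[_ /(_ v) cvw]] := C2.
pose A := 'D_w ('D_v f) x; pose B := 'D_v ('D_w f) x; rewrite -[LHS]/A -[RHS]/B.
apply/eqP; rewrite -subr_eq0 -normr_eq0; apply/negPn/negP => E.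
pose e := `|A - B| / 2.
have e0 : 0 < e by rewrite divr_gt0// lt_def E /=.
have /cvgrPdist_lt/(_ e e0) nA : 'D_w ('D_v f) z @[z --> x] --> A by exact: cwv.
have /cvgrPdist_lt/(_ e e0) nB : 'D_v ('D_w f) z @[z --> x] --> B by exact: cvw.
have nU : nbhs x U by exact: open_nbhs_nbhs.
have : nbhs x (U `&` ([set z | `|A - 'D_w ('D_v f) z| < e] `&` [set z | `|B - 'D_v
  ('D_w f) z| < e])).
  exact: (filterI nU (filterI nA nB)).
move=> /nbhs_ballP[r /= r0 Br].
(* This size keeps the parallelogram spanned by [h *: v] and [h *: w] inside the ball of radius [r];
   the summand 1 covers [v = w = 0]. *)
pose h := r / (`|v| + `|w| + 1) / 2.
have n0 : 0 < `|v| + `|w| + 1 by rewrite ltr_wpDl// addr_ge0.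
have h0 : 0 < h by rewrite !divr_gt0.
have hr : h * (`|v| + `|w|) < r.
  have hE : h * (`|v| + `|w| + 1) = r / 2 by rewrite /h mulrAC divfK// gt_eqF.
  by move: hE h0; rewrite mulrDr mulr1; lra.
have inB s t (a b : V) : `|a| + `|b| = `|v| + `|w| -> 0 <= s <= h -> 0 <= t <= h ->
  ball x r (x + s *: a + t *: b).
  move=> ab /andP[s0 sh] /andP[t0 th];
    rewrite -ball_normE /= -addrA opprD addrA subrr sub0r normrN.
  apply: le_lt_trans hr; rewrite -ab mulrDr; apply: le_trans (ler_normD _ _) _.
  by rewrite !normrZ !ger0_norm// lerD// ler_wpM2r.
have [|s1 [t1 [hs1 ht1 E1]]] := @second_difference _ _ U f x v w h h0 C2.
  by move=> s t hs ht; have [] := Br _ (inB s t v w erefl hs ht).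
have [|s2 [t2 [hs2 ht2 E2]]] := @second_difference _ _ U f x w v h h0 C2.
  by move=> s t hs ht; have [] := Br _ (inB s t w v (addrC _ _) hs ht).
have weak (a b c : R) : a < b < c -> a <= b <= c by case/andP => *; rewrite !ltW.
have [_ [D1 _]] := Br _ (inB s1 t1 v w erefl (weak _ _ _ hs1) (weak _ _ _ ht1)).
have [_ [_ D2]] := Br _ (inB s2 t2 w v (addrC _ _) (weak _ _ _ hs2) (weak _ _ _ ht2)).
move: E1 E2 D1 D2 => /=; set m1 := derive _ (_ + _) w; set m2 := derive _ (_ + _) v.
clear nA nB Br inB; clearbody A B m1 m2 => E1 E2 D1 D2.
have swap : m1 = m2.
  have h20 : h ^+ 2 != 0 by rewrite expf_neq0// gt_eqF.
  apply: (mulfI h20); rewrite -E1 -E2 [x + h *: w + _]addrAC !opprB.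
  by rewrite addrACA [RHS]addrACA [X in _ = _ + X]addrC.
rewrite swap in D1.
have : `|A - B| < 2 * e.
  have -> : A - B = (A - m2) - (B - m2) by ring.
  by apply: le_lt_trans (ler_normB _ _) _; rewrite mulr_natl mulr2n ltrD.
by rewrite /e mulrC divfK// ltxx.
Qed.

(** * The metric on a tangent space *)

Section Metric.
Variables (R : realType) (n : nat).

(** * Symmetric bilinear forms on row vectors *)

Section SymmetricBilinear.
Variable B : 'rV[R]_n -> 'rV[R]_n -> R.
Hypothesis B_sym : forall u v, B u v = B v u.
Hypothesis B_linear : forall a u v w, B (a *: u + v) w = a * B u w + B v w.

Lemma form0l w : B 0 w = 0.
Proof. by have := B_linear (-1) 0 0 w; rewrite scaler0 add0r; lra. Qed.

Lemma formDl u v w : B (u + v) w = B u w + B v w.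
Proof. by have := B_linear 1 u v w; rewrite scale1r mul1r. Qed.

Lemma formZl a u w : B (a *: u) w = a * B u w.
Proof. by have := B_linear a u 0 w; rewrite addr0 form0l addr0. Qed.

Lemma form_suml (I : Type) (r : seq I) (F : I -> 'rV[R]_n) w :
  B (\sum_(i <- r) F i) w = \sum_(i <- r) B (F i) w.
Proof.
elim: r => [|i r IH]; first by rewrite !big_nil form0l.
by rewrite !big_cons formDl IH.
Qed.

Lemma form_coord u w : B u w =
  \sum_i \sum_j u 0 i * w 0 j * B (delta_mx 0 i) (delta_mx 0 j).
Proof.
rewrite {1}(row_sum_delta u) form_suml; apply: eq_bigr => i _.
rewrite formZl B_sym {1}(row_sum_delta w) form_suml mulr_sumr.
by apply: eq_bigr => j _; rewrite formZl B_sym mulrA.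
Qed.

Lemma form_diag_continuous : continuous (fun v => B v v).
Proof.
move=> v; have oT : open [set: 'rV[R]_n] by exact: openT.
suff C : Ck_on 0 [set: 'rV[R]_n] (fun v => B v v) by exact: C.
rewrite (_ : (fun v => B v v) = fun v => \sum_i \sum_j v 0 i * v 0 j * B (delta_mx 0
  i) (delta_mx 0 j)); last by apply/funext => w; rewrite form_coord.
have CX i : Ck_on 0 [set: 'rV[R]_n] (fun v => v 0 i).
  by apply: (@Ck_on_coord _ _ _ _ _ id) => // x _; exact: cvg_id.
apply: (@Ck_on_sum R 'rV[R]_n R 0 n setT (fun i v => \sum_j v 0 i * v 0 j * B
  (delta_mx 0 i) (delta_mx 0 j))) => // i.
apply: (@Ck_on_sum R 'rV[R]_n R 0 n setT (fun j v => v 0 i * v 0 j * B (delta_mx 0 i)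
  (delta_mx 0 j))) => // j.
apply: (@Ck_onM R 'rV[R]_n 0 setT (fun v => v 0 i * v 0 j) (cst _)) => //.
  exact: (@Ck_onM R 'rV[R]_n 0 setT (fun v => v 0 i) (fun v => v 0 j)).
exact: Ck_on_cst.
Qed.

(** An isotropic vector of a positive semidefinite form lies in its kernel: otherwise the form,
    which is affine in [a] at [a *: v0 + w], would take negative values. *)
Lemma form_kernel v0 : (forall v, 0 <= B v v) -> B v0 v0 = 0 ->
  forall w, B v0 w = 0.
Proof.
move=> B0 Bv0 w; have [//|Bn] := eqVneq (B v0 w) 0.
(* Solves [2 * a * B v0 w + B w w = -1]. *)
pose a := - (B w w + 1) / (2 * B v0 w).
have := B0 (a *: v0 + w); rewrite B_linear ![B _ (_ + _)]B_sym !B_linear Bv0.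
have -> : a * (a * 0 + B w v0) + (a * B v0 w + B w w) = - 1.
  by rewrite (B_sym w) /a; field.
by rewrite lerNr oppr0 ler10.
Qed.

End SymmetricBilinear.

Variables (M : riemannian_manifold R n) (y : M).
Implicit Types u v w : 'rV[R]_n.

Lemma metric0l w : metric y 0 w = 0. Proof. exact/form0l/metric_linear. Qed.
Lemma metricDl u v w : metric y (u + v) w = metric y u w + metric y v w.
Proof. exact/formDl/metric_linear. Qed.
Lemma metricZl a u w : metric y (a *: u) w = a * metric y u w.
Proof. exact/formZl/metric_linear. Qed.
Lemma metricZr a u w : metric y u (a *: w) = a * metric y u w.
Proof. by rewrite Defs.metric_sym metricZl Defs.metric_sym. Qed.
Lemma metricNl u w : metric y (- u) w = - metric y u w.
Proof. by rewrite -scaleN1r metricZl mulN1r. Qed.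
Lemma metricDr u v w : metric y u (v + w) = metric y u v + metric y u w.
Proof. by rewrite Defs.metric_sym metricDl !(Defs.metric_sym _ u). Qed.

Lemma metric_ge0 v : 0 <= metric y v v.
Proof. by have [->|/metric_posdef/ltW] := eqVneq v 0; first rewrite metric0l. Qed.

Lemma metric_eq0 v : metric y v v = 0 -> v = 0.
Proof.
move=> v0; apply/eqP; apply: contraT => /(metric_posdef y).
by rewrite v0 ltxx.
Qed.

Lemma metric_inj u w : (forall v, metric y u v = metric y w v) -> u = w.
Proof.
move=> uw; apply/eqP; rewrite -subr_eq0; apply/eqP/metric_eq0.
by rewrite metricDl metricNl uw subrr.
Qed.

Lemma rnorm_ge0 v : 0 <= rnorm y v. Proof. exact: sqrtr_ge0. Qed.

Lemma rnorm_sqr v : rnorm y v ^+ 2 = metric y v v.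
Proof. by rewrite sqr_sqrtr// metric_ge0. Qed.

Lemma rnorm_eq0 v : rnorm y v = 0 -> v = 0.
Proof. by move=> v0; apply: metric_eq0; rewrite -rnorm_sqr v0 expr0n. Qed.

Lemma rnormZ a v : rnorm y (a *: v) = `|a| * rnorm y v.
Proof.
by rewrite /rnorm metricZl metricZr mulrA -expr2 sqrtrM ?sqr_ge0// sqrtr_sqr.
Qed.

Lemma rnormN v : rnorm y (- v) = rnorm y v.
Proof. by rewrite -scaleN1r rnormZ normrN normr1 mul1r. Qed.

(** Cauchy-Schwarz, from the positivity of the metric at the combination [<v,v> u - <u,v> v]. *)
Lemma metric_le_rnorm u v : `|metric y u v| <= rnorm y u * rnorm y v.
Proof.
rewrite -[leLHS]ger0_norm// -[leRHS]ger0_norm ?mulr_ge0 ?rnorm_ge0//.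
rewrite -ler_sqr ?nnegrE// !real_normK ?num_real// exprMn !rnorm_sqr.
have [->|v0] := eqVneq v 0;
  first by rewrite !(Defs.metric_sym _ _ 0) !metric0l expr0n mulr0.
have vv := metric_posdef y v0; set a := metric y u v; set b := metric y v v in vv *.
have := metric_ge0 (b *: u + (- a) *: v).
rewrite metricDl !metricDr !metricZl !metricZr (Defs.metric_sym _ v u) -/a -/b.
set c := metric y u u.
have -> : b * (b * c) + b * (- a * a) + (- a * (b * a) + - a * (- a * b)) = b * (c *
  b - a ^+ 2) by ring.
by rewrite pmulr_rge0// subr_ge0.
Qed.

(** The rows of the inverse Gram matrix; positive definiteness makes the Gram matrix invertible. *)
Lemma dual_basis_exists :
  exists b : 'I_n -> 'rV[R]_n, forall i v, metric y (b i) v = v 0 i.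
Proof.
pose G : 'M[R]_n := \matrix_(i, j) metric y (delta_mx 0 i) (delta_mx 0 j).
have GE u v : metric y u v = (u *m G *m v^T) 0 0.
  rewrite (form_coord (Defs.metric_sym y) (metric_linear y)) mxE.
  under [RHS]eq_bigr do rewrite !mxE mulr_suml.
  rewrite [RHS]exchange_big/=; apply: eq_bigr => i _; apply: eq_bigr => j _.
  by rewrite mxE mulrAC.
have Gu : G \in unitmx.
  rewrite -row_free_unit -kermx_eq0; apply/rowV0P => v /sub_kermxP vG.
  by apply: metric_eq0; rewrite GE vG mul0mx mxE.
exists (fun i => row i (invmx G)) => i v; rewrite GE -row_mul mulVmx// row1.
by rewrite -rowE !mxE.
Qed.

(** ['d f s] is linear for every [f], so the dual basis provides a Riesz representative and [xget]
    returns one. *)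
Lemma metric_gradT (f : 'rV[R]_n -> R) s v : metric y (gradT y f s) v = 'd f s v.
Proof.
have [b bE] := dual_basis_exists.
suff : [set w | forall v, metric y w v = 'd f s v] (gradT y f s) by apply.
apply: xgetPex; exists (\sum_i 'd f s (delta_mx 0 i) *: b i) => {}v.
rewrite (form_suml (metric_linear y)) {2}(row_sum_delta v) linear_sum.
by apply: eq_bigr => i _; rewrite metricZl bE linearZ mulrC.
Qed.

(** The vectors [b i] do not depend on [s], so this form of the gradient can be differentiated in
    [s]. *)
Lemma gradT_dual_basis (b : 'I_n -> 'rV[R]_n) (f : 'rV[R]_n -> R) s :
  (forall i v, metric y (b i) v = v 0 i) ->
  gradT y f s = \sum_i 'd f s (delta_mx 0 i) *: b i.
Proof.
move=> bE; apply: metric_inj => v; rewrite metric_gradT.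
rewrite (form_suml (metric_linear y)) {1}(row_sum_delta v) linear_sum.
by apply: eq_bigr => i _; rewrite metricZl bE linearZ mulrC.
Qed.

(** Let [mu] be the minimum of the Rayleigh quotient, attained at [v0]. The form of [H] minus [mu]
    times the metric is positive semidefinite and vanishes at [v0], so [v0] lies in its kernel, that
    is, [v0] is an eigenvector for [mu], whence [lam <= mu]. *)
Lemma rayleigh_ge (H : 'rV[R]_n -> 'rV[R]_n) (lam : R) v :
  (forall a u w, H (a *: u + w) = a *: H u + H w) ->
  (forall u w, metric y u (H w) = metric y w (H u)) ->
  least_eigenvalue H lam -> lam * metric y v v <= metric y v (H v).
Proof.
move=> Hl Hs [[e [e0 _]] lam_le].
pose q w := metric y w (H w) / metric y w w.
(* The quotient is invariant under scaling, so it can be minimized over the unit sphere of the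
   ambient norm, which is compact. *)
pose S := [set w : 'rV[R]_n | `|w| = 1].
have normS w : w != 0 -> S (`|w|^-1 *: w).
  by move=> w0; rewrite /S/= normrZ normfV normr_id mulVf// normr_eq0.
have S0 w : S w -> w != 0 by move=> w1; rewrite -normr_eq0 w1 oner_eq0.
have cS : compact S.
  apply: bounded_closed_compact.
    by exists 1; split => // r r1 w /= ->; exact: ltW.
  rewrite (_ : S = (fun w : 'rV[R]_n => `|w|) @^-1` [set 1])//.
  apply: closed_comp => [w _|]; first exact: norm_continuous.
  exact: closed_eq.
have HsB u w : metric y u (H w) = metric y w (H u) by exact: Hs.
have HlB (a : R) u w z : metric y (a *: u + w) (H z) = a * metric y u (H z) + metric
  y w (H z).
  exact: metric_linear.
have cq : {within S, continuous q}.
  apply: continuous_in_subspaceT => w /set_mem/S0 w0.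
  apply: (@continuousM _ _ (fun w => metric y w (H w)) (fun w => (metric y w w)^-1)).
    exact: (form_diag_continuous HsB HlB).
  apply: (@continuousV _ _ (fun w => metric y w w));
    first by rewrite gt_eqF// metric_posdef.
  exact: (form_diag_continuous (Defs.metric_sym y) (metric_linear y)).
(* The given eigenvector [e], normalized, shows that the sphere is nonempty. *)
have [|v0 /set_mem/S0 v00 qmin] := EVT_min_rV _ cS cq;
  first by exists (`|e|^-1 *: e); exact: normS.
set mu := q v0 in qmin.
pose B u w := metric y u (H w) - mu * metric y u w.
have BS u w : B u w = B w u by rewrite /B Hs (Defs.metric_sym y u).
have BL a u w z : B (a *: u + w) z = a * B u z + B w z by rewrite /B !metric_linear;
  ring.
have H0 : H 0 = 0 by have := Hl (-1) 0 0; rewrite scaler0 add0r scaleN1r addNr.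
have HZ a w : H (a *: w) = a *: H w by have := Hl a w 0; rewrite H0 !addr0.
have B0 w : 0 <= B w w.
  have [->|w0] := eqVneq w 0; first by rewrite /B !metric0l mulr0 subr0.
  have := qmin _ (mem_set (normS _ w0)); rewrite /q HZ !metricZl !metricZr.
  have r0 : `|w|^-1 != 0 by rewrite invr_eq0 normr_eq0.
  rewrite !mulrA -mulf_div divff ?mulf_neq0// mul1r ler_pdivlMr ?metric_posdef//.
  by rewrite /B subr_ge0.
have Bv0 : B v0 v0 = 0.
  by rewrite /B /mu /q divfK ?subrr// gt_eqF// metric_posdef.
have Hv0 : H v0 = mu *: v0.
  apply: metric_inj => w; have := form_kernel BS BL B0 Bv0 w.
  by rewrite /B Hs metricZl => /subr0_eq <-; rewrite Defs.metric_sym.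
apply: (@le_trans _ _ (mu * metric y v v)); last by rewrite -subr_ge0; exact: B0.
by rewrite ler_wpM2r ?metric_ge0//; apply: (lam_le mu v0).
Qed.

End Metric.

(** * Pullbacks along the retraction *)

Lemma derive_sumE (R : realType) (V W : normedModType R) (n : nat)
    (f : 'I_n -> V -> W) (x v : V) : (forall i, derivable (f i) x v) ->
  'D_v (fun z => \sum_i f i z) x = \sum_i 'D_v (f i) x.
Proof.
move=> df; rewrite -derive_sum//; congr (derive _ _ _).
by rewrite funeqE => z; rewrite fct_sumE.
Qed.

(* At a critical point of [h] only the first derivative of [F] contributes. *)
Lemma derive2_comp_critical (R : realType) (V : normedModType R) (n : nat)
    (U : set V) (U' : set 'rV[R]_n) (F : V -> 'rV[R]_n) (h : 'rV[R]_n -> R)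
    (x v : V) :
    open U -> U x -> (forall z, U z -> U' (F z)) ->
    Ck_on 2 U F -> Ck_on 2 U' h -> (forall w, 'D_w h (F x) = 0) ->
  'D_v ('D_v (h \o F)) x =
  \sum_i \sum_j ('D_v F x) 0 i * ('D_v F x) 0 j *
    'D_(delta_mx 0 j) ('D_(delta_mx 0 i) h) (F x).
Proof.
move=> oU Ux UU' [dF CF] [dh Ch] h0.
pose a i z := ('D_v F z) 0 i; pose b i := 'D_(delta_mx 0 i) h.
have da i : differentiable (a i) x.
  have [dDF _] := CF v;
    apply: (@differentiable_comp _ _ _ _ ('D_v F) (fun N : 'rV[R]_n => N 0 i)).
    exact: dDF.
  exact: differentiable_coord.
have db i : differentiable (b i) (F x) by have [dDh _] := Ch (delta_mx 0 i);
  exact/dDh/UU'.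
have dbF i : differentiable (b i \o F) x.
  by apply: differentiable_comp; [exact: dF|exact: db].
have -> : 'D_v ('D_v (h \o F)) x = 'D_v (fun z => \sum_i a i z * (b i \o F) z) x.
  apply: near_eq_derive; near=> z.
  have Uz : U z by near: z; exact: open_nbhs_nbhs.
  by rewrite derive_chain//; [exact: dF|exact/dh/UU'].
rewrite (derive_sumE (f := fun i z => a i z * (b i \o F) z)); last first.
  by move=> i; apply: derivableM; exact: diff_derivable.
apply: eq_bigr => i _; rewrite (deriveM (f := a i) (g := b i \o F));
  [|exact: diff_derivable|exact: diff_derivable].
rewrite /= [b i (F x)]h0 scale0r addr0 derive_chain; [|exact: dF|exact: db].
by rewrite scaler_sumr; apply: eq_bigr => j _; rewrite /a /b -mulrA.
Unshelve. all: by end_near. Qed.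

(** * The Hessian of a C^2 function on a tangent space *)

Section Hessian.
Variables (R : realType) (n : nat) (M : riemannian_manifold R n) (y : M).
Variables (U : set 'rV[R]_n) (f : 'rV[R]_n -> R).
Hypotheses (U_open : open U) (U0 : U 0) (f_C2 : Ck_on 2 U f).

(** Near 0 the gradient is a combination of the constant vectors [b i] whose coefficients, the
    partial derivatives of [f], are differentiable. *)
Lemma hessT_coord (b : 'I_n -> 'rV[R]_n) v :
  (forall i v, metric y (b i) v = v 0 i) ->
  differentiable (gradT y f) 0 /\
  hessT y f 0 v = \sum_i 'D_v ('D_(delta_mx 0 i) f) 0 *: b i.
Proof.
move=> bE; have [df Cf] := f_C2.
have dDf w : differentiable ('D_w f) 0 by have [dDf _] := Cf w; exact: dDf.
have dZ i : differentiable (fun s => 'D_(delta_mx 0 i) f s *: b i) 0.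
  exact: differentiableZl.
have gE : \forall s \near (0 : 'rV[R]_n), (\sum_i (fun s => 'D_(delta_mx 0 i) f s *:
  b i)) s = gradT y f s.
  near=> s; rewrite (gradT_dual_basis f s bE) fct_sumE.
  have Us : U s by near: s; exact: open_nbhs_nbhs.
  by apply: eq_bigr => i _; rewrite deriveE//; exact: df.
split.
  by apply: near_eq_differentiable gE _; exact: differentiable_sum.
rewrite /hessT -(near_eq_derive v gE) derive_sum; last by move=> i;
  exact: diff_derivable.
apply: eq_bigr => i _; rewrite deriveE; last exact: dZ.
by rewrite diffZl// deriveE.
Unshelve. all: by end_near. Qed.

Lemma metric_hessT v w : metric y (hessT y f 0 v) w = 'D_v ('D_w f) 0.
Proof.
have [b bE] := dual_basis_exists y; have [_ ->] := hessT_coord v bE.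
have [df Cf] := f_C2.
have dDf z : differentiable ('D_z f) 0 by have [dDf _] := Cf z; exact: dDf.
rewrite (form_suml (metric_linear y)).
have -> : 'D_v ('D_w f) 0 = 'D_v (fun s => \sum_i w 0 i *: 'D_(delta_mx 0 i) f s) 0.
  apply: near_eq_derive; near=> s.
  have Us : U s by near: s; exact: open_nbhs_nbhs.
  by rewrite derive_sum_coord//; exact: df.
rewrite derive_sumE; last by move=> i; apply: derivableZ; exact: diff_derivable.
apply: eq_bigr => i _; rewrite metricZl bE deriveZ; last exact: diff_derivable.
by rewrite mulrC.
Unshelve. all: by end_near. Qed.

Lemma hessT_linear a u w : hessT y f 0 (a *: u + w) = a *: hessT y f 0 u + hessT y f
  0 w.
Proof.
have [b bE] := dual_basis_exists y; have [dg _] := hessT_coord 0 bE.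
by rewrite /hessT !deriveE// linearP.
Qed.

Lemma hessT_sym u w : metric y u (hessT y f 0 w) = metric y w (hessT y f 0 u).
Proof.
rewrite Defs.metric_sym metric_hessT [RHS]Defs.metric_sym metric_hessT.
exact: derive_comm f_C2.
Qed.

End Hessian.

Section RetractionCharts.
Variables (R : realType) (n : nat) (M : riemannian_manifold R n).
Variables (Rt : M -> 'rV[R]_n -> M) (Rt_retraction : retraction Rt).
Variables (g : M -> R) (g_C2 : C2_function g).
Implicit Types (c d : chart R n M) (y : M).

(** The transition map from a chart to itself is the identity near the point. *)
Lemma tangent_of_chart_at y w : tangent_of (chart_at y) y w = w.
Proof.
set c := chart_at y; have yc : cdom c y := chart_at_dom y.
have E : \forall x \near cphi c y, x = (cphi c \o cpsi c) x.
  near=> x; rewrite /= cpsiK//; near: x.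
  by apply: open_nbhs_nbhs; split; [exact: cimg_open|exact: cphi_img].
have d1 : differentiable (cphi c \o cpsi c) (cphi c y) by exact:
  near_eq_differentiable E _.
by rewrite /tangent_of -/c -deriveE// -(near_eq_derive w E) derive_id.
Unshelve. all: by end_near. Qed.

(** The retraction read in the chart of the tangent bundle induced by [c]. With the single chart [c]
    it varies smoothly with the base point, whereas the coordinates used by [Rt y] may jump with
    [chart_at y]. *)
Definition retr_chart c (p : 'rV[R]_n * 'rV[R]_n) : M :=
  Rt (cpsi c p.1) (tangent_of c (cpsi c p.1) p.2).

Definition retr_dom c d : set ('rV[R]_n * 'rV[R]_n) :=
  [set p | cimg c p.1] `&` retr_chart c @^-1` cdom d.

Lemma retr_dom_open c d : atlas c -> atlas d -> open (retr_dom c d).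
Proof. by move=> ac ad; have [] := retraction_smooth Rt_retraction ac ad. Qed.

Lemma retr_chart_Ck k c d : atlas c -> atlas d ->
  Ck_on k (retr_dom c d) (cphi d \o retr_chart c).
Proof. by move=> ac ad; have [_] := retraction_smooth Rt_retraction ac ad; apply. Qed.

Lemma comp_retr_chart_C2 c d : atlas c -> atlas d ->
  Ck_on 2 (retr_dom c d) (g \o retr_chart c).
Proof.
move=> ac ad; have oU := retr_dom_open ac ad.
apply: (@Ck_on_ext _ _ _ _ _ ((g \o cpsi d) \o (cphi d \o retr_chart c))) => //.
  by move=> p [_ pd] /=; rewrite cphiK.
apply: (@Ck_on_comp _ _ _ _ _ (cimg d)) => //; last exact: g_C2.
  by move=> p [_ pd]; exact: cphi_img.
exact: retr_chart_Ck.
Qed.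

Lemma retr_chart_at y w :
  retr_chart (chart_at y) (cphi (chart_at y) y, w) = Rt y w.
Proof.
have yc := chart_at_dom y.
by rewrite /retr_chart /= cphiK// tangent_of_chart_at.
Qed.

(** The properties of [retr_chart] restricted to the fibre over [y]. *)
Lemma retraction_at_C2 y : exists U : set 'rV[R]_n,
  [/\ open U, U 0, Ck_on 2 U (cphi (chart_at y) \o Rt y),
      forall v, U v -> cdom (chart_at y) (Rt y v)
    & Ck_on 2 U (pullback Rt g y)].
Proof.
set c := chart_at y; set x := cphi c y.
have ac : atlas c := chart_at_atlas y; have yc : cdom c y := chart_at_dom y.
have RE v : Rt y v = retr_chart c (x, v) by rewrite retr_chart_at.
exists [set w | retr_dom c c (x, w)]; split.
- apply: (@open_comp _ _ (fun w => (x, w))); last exact: retr_dom_open.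
  by move=> w _; apply: differentiable_continuous; exact: differentiable_pair.
- by split => /=; [exact: cphi_img|rewrite retr_chart_at retraction0].
- have -> : cphi c \o Rt y = fun w => (cphi c \o retr_chart c) (x, w).
    by rewrite funeqE => w /=; rewrite RE.
  by apply: Ck_on_slice; exact: retr_chart_Ck.
- by move=> v [_]; rewrite /= retr_chart_at.
- have -> : pullback Rt g y = fun w => (g \o retr_chart c) (x, w).
    by rewrite funeqE => w /=; rewrite /pullback /= RE.
  by apply: Ck_on_slice; exact: comp_retr_chart_C2.
Qed.

Lemma derive_retraction y w : 'D_w (cphi (chart_at y) \o Rt y) 0 = w.
Proof.
rewrite -[RHS](retraction_velocity Rt_retraction y w) /velocity derive1E scale0r.
rewrite (retraction0 Rt_retraction) /derive.
set p := (X in lim (X @ _) = _); set q := (X in _ = lim (X @ _)).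
suff -> : p = q by []; rewrite funeqE => h; rewrite /p /q /=.
by rewrite !addr0 scale0r [h%:A]mulr1.
Qed.

(** Chain rule: in the chart at [y], the retraction has the identity as differential at 0. *)
Lemma diff_pullback y v :
  'd (pullback Rt g y) 0 v = 'd (g \o cpsi (chart_at y)) (cphi (chart_at y) y) v.
Proof.
have [U [oU U0 [dF _] Ud [dp _]]] := retraction_at_C2 y.
have [dh _] := g_C2 (chart_at_atlas y).
have F0 : (cphi (chart_at y) \o Rt y) 0 = cphi (chart_at y) y by rewrite /= retraction0.
have dhx : differentiable (g \o cpsi (chart_at y)) (cphi (chart_at y) y).
  by apply: dh; exact/cphi_img/chart_at_dom.
apply: etrans (esym (deriveE v (dp 0 U0))) _.
rewrite (near_eq_derive (g := (g \o cpsi (chart_at y)) \o (cphi (chart_at y) \o Rt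
  y))); last first.
  near=> w; rewrite /pullback /= cphiK//; apply: Ud.
  by near: w; exact: open_nbhs_nbhs.
rewrite derive_chain; [|exact: (dF 0 U0)|by rewrite F0].
by rewrite F0 derive_retraction -derive_sum_coord// deriveE.
Unshelve. all: by end_near. Qed.

Lemma gradT_pullback y : gradT y (pullback Rt g y) 0 = grad g y.
Proof.
apply: (metric_inj (y := y)) => v; apply: etrans (metric_gradT _ _ _ _) _.
by apply: etrans (diff_pullback _ _) _; apply: esym; exact: metric_gradT.
Qed.

Lemma derive_pullback y v : 'D_v (pullback Rt g y) 0 = metric y (grad g y) v.
Proof.
have [U [oU U0 _ _ [dp _]]] := retraction_at_C2 y.
rewrite -gradT_pullback; apply: etrans (deriveE _ (dp 0 U0)) _.
by apply: esym; exact: metric_gradT.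
Qed.

Lemma metric_hess_pullback y v w :
  metric y (hess_pullback Rt g y v) w = 'D_v ('D_w (pullback Rt g y)) 0.
Proof. by have [U [oU U0 _ _ C]] := retraction_at_C2 y; exact: metric_hessT C _ _. Qed.

Lemma hess_pullback_linear y a u w : hess_pullback Rt g y (a *: u + w) =
  a *: hess_pullback Rt g y u + hess_pullback Rt g y w.
Proof. by have [U [oU U0 _ _ C]] := retraction_at_C2 y;
  exact: hessT_linear C _ _ _. Qed.

Lemma hess_pullback_sym y u w :
  metric y u (hess_pullback Rt g y w) = metric y w (hess_pullback Rt g y u).
Proof. by have [U [oU U0 _ _ C]] := retraction_at_C2 y; exact: hessT_sym C _ _. Qed.

Lemma hess_pullback0 y : hess_pullback Rt g y 0 = 0.
Proof. by have := hess_pullback_linear y (-1) 0 0;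
  rewrite scaler0 add0r scaleN1r addNr. Qed.

Lemma hess_pullbackZ y a u : hess_pullback Rt g y (a *: u) = a *: hess_pullback Rt g
  y u.
Proof. by have := hess_pullback_linear y a u 0; rewrite hess_pullback0 !addr0. Qed.

End RetractionCharts.

(** * Counting iterations *)

Section Counting.
Variables (P S : pred nat).

(** The length of the run of consecutive failures that ends just before [k]. *)
Fixpoint fails k : nat := if k is k'.+1 then (if P k' then 0 else (fails k').+1) else 0.

Lemma count_iotaS (Q : pred nat) N : count Q (iota 0 N.+1) = (count Q (iota 0 N) + Q
  N)%N.
Proof. by rewrite -addn1 iotaD count_cat /= add0n addn0. Qed.

(** [S] is constant along a block of failures and the success that closes it, a block of at most [C]
    indices. The term [fails N * S N] accounts for the block still open at [N]. *)
Lemma count_fails (C : nat) : (forall k, ~~ P k -> S k.+1 = S k) ->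
    (forall k, (fails k < C)%N) -> forall N,
  (count S (iota 0 N) <= C * count (predI P S) (iota 0 N) + fails N * S N)%N.
Proof.
move=> SS fC; elim=> [|N IH]; first by rewrite muln0.
rewrite !count_iotaS /=; have := fC N; have := @SS N; case: (P N) => /=.
  by move=> _ fN; rewrite mul0n addn0; case: (S N) IH => /=; nia.
by move=> -> // _; case: (S N) IH => /=; nia.
Qed.

(** Without a success from [N] on, the run of failures would exceed [C]. *)
Lemma exists_success (C : nat) : (forall k, (fails k < C)%N) -> forall N,
  exists2 k, (N <= k)%N & P k.
Proof.
move=> fC N; apply: contrapT => nP.
have f k : (k <= fails (N + k))%N.
  elim: k => // k IH; rewrite addnS /=; case: ifP => // Pk.
  by exfalso; apply: nP; exists (N + k)%N; rewrite // leq_addr.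
by have := fC (N + C)%N; rewrite ltnNge f.
Qed.

Lemma count_blocks (C F : nat) : (forall k, ~~ P k -> S k.+1 = S k) ->
    (forall k, (fails k < C)%N) ->
    (forall N, (count (predI P S) (iota 0 N) <= F)%N) ->
  forall N, (count S (iota 0 N) <= C * F)%N.
Proof.
(* Just after a success no block is open, so the extra term of [count_fails] vanishes at [k.+1]. *)
move=> SS fC cF N; have [k Nk Pk] := exists_success fC N.
have := count_fails SS fC k.+1; rewrite [fails _]/= Pk mul0n addn0 => ck.
have CF : (C * count (predI P S) (iota 0 k.+1) <= C * F)%N by rewrite leq_mul2l cF orbT.
apply: leq_trans CF; apply: leq_trans ck.
by rewrite -(subnKC (leqW Nk)) iotaD count_cat leq_addr.
Qed.

End Counting.

(** Every finite subset of [A] lies in an initial segment, so it has at most [B] elements; an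
    infinite [A] would contain one with [B.+1]. *)
Lemma count_bounded_finite (A : set nat) (B : nat) :
  (forall N, (count (fun k => k \in A) (iota 0 N) <= B)%N) ->
  finite_set A /\ (#|` fset_set A| <= B)%N.
Proof.
move=> cB.
have fB (X : {fset nat}) : [set` X] `<=` A -> (#|` X| <= B)%N.
  move=> XA; have [N XN] : exists N, forall k, k \in X -> (k < N)%N.
    exists (\max_(k <- enum_fset X) k).+1 => k kX; rewrite ltnS.
    exact: (@leq_bigmax_seq _ _ xpredT id).
  apply: leq_trans (cB N); rewrite -size_filter; apply: uniq_leq_size;
    first exact: fset_uniq.
  move=> k kX; rewrite mem_filter mem_iota /= add0n XN// andbT; apply/mem_set.
  exact: XA.
have fA : finite_set A.
  apply: contrapT => /(infinite_set_fset B.+1)[X XA].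
  by rewrite ltnNge fB.
by split=> //; apply: fB; rewrite fset_setK.
Qed.

(** * The constant [gamma_min] *)

Section GammaMin.
Variables (R : realType) (gamc eta gamlo L1 L2 : R).
Hypotheses (gamc01 : 0 < gamc < 1) (eta01 : 0 < eta < 1) (gamlo_gt0 : 0 < gamlo).
Hypotheses (L1_ge0 : 0 <= L1) (L2_ge0 : 0 <= L2).
Local Notation gm := (gamma_min gamc eta gamlo L1 L2).

Lemma frac_or_infty_gt0 (a b : R) : 0 < a -> 0 <= b -> (0 < frac_or_infty a b)%E.
Proof.
move=> a0 b0; rewrite /frac_or_infty; case: eqVneq => // bn.
by rewrite lte_fin divr_gt0// lt_def bn.
Qed.

Lemma le_frac_or_infty (x a b : R) : 0 < a -> 0 <= b ->
  (x%:E <= frac_or_infty a b)%E -> x * b <= a.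
Proof.
move=> a0 b0; rewrite /frac_or_infty; case: eqVneq => [->|bn].
  by move=> _; rewrite mulr0 ltW.
by rewrite lee_fin ler_pdivlMr// lt_def bn.
Qed.

(** The bounds are stated with denominators cleared, a form that also covers [L1 = 0] and
    [L2 = 0]. *)
Lemma gamma_min_spec : [/\ 0 < gm, gm <= gamlo, gm * (1 + L1) <= gamc,
  gm * (2 * L1) <= gamc * (1 - eta) & gm * L2 <= 3 * gamc * (1 - eta)].
Proof.
have [/andP[gc0 gc1] /andP[e0 e1]] := (gamc01, eta01).
have a1 : 0 < gamc * (1 - eta) by rewrite mulr_gt0// subr_gt0.
have a2 : 0 < 3 * gamc * (1 - eta) by rewrite -mulrA mulr_gt0.
have b1 : 0 <= 2 * L1 by rewrite mulr_ge0.
have l1 : 0 < 1 + L1 by rewrite ltr_pwDl.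
rewrite /gamma_min; set x := mine (mine _ _) (mine _ _).
have x0 : (0 < x)%E.
  by rewrite /x !lt_min !frac_or_infty_gt0// !lte_fin gamlo_gt0 divr_gt0.
have [xlo x1 x2 x3] : [/\ (x <= gamlo%:E)%E, (x <= (gamc / (1 + L1))%:E)%E,
    (x <= frac_or_infty (gamc * (1 - eta)) (2 * L1))%E &
    (x <= frac_or_infty (3 * gamc * (1 - eta)) L2)%E].
  by split; rewrite /x !ge_min lexx ?orbT.
have xf : x \is a fin_num.
  by rewrite fin_real// (lt_trans ltNy0 x0) (le_lt_trans xlo) ?ltry.
move: x0 xlo x1 x2 x3; rewrite -(fineK xf); set r := fine x.
rewrite lte_fin !lee_fin ler_pdivlMr// => r0 rlo r1 /(le_frac_or_infty a1 b1) r2.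
by move=> /(le_frac_or_infty a2 L2_ge0) r3.
Qed.

Lemma gamma_min_lt1 : gm < 1.
Proof.
have [g0 _ g1 _ _] := gamma_min_spec; have /andP[_ gc1] := gamc01.
apply: le_lt_trans gc1; apply: le_trans g1.
by move: L1_ge0 g0; nra.
Qed.

End GammaMin.

(** * Acceptance and decrease for a single trust-region step *)

Section TrustRegionStep.
Variables (R : realType) (n : nat) (M : riemannian_manifold R n).
Variables (Rt : M -> 'rV[R]_n -> M) (Rt_retraction : retraction Rt).
Variables (g : M -> R) (g_C2 : C2_function g).
Variables (y : M) (L1 L2 gam lam delta t eta : R) (u s : 'rV[R]_n).
Local Notation H := (hess_pullback Rt g y).
Local Notation N := (rnorm y (grad g y)).
Local Notation Lam := `|negpart lam|.
Local Notation curvature_step := ((lam < 0) && (N ^+ 2 < Lam ^+ 3)).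
Local Notation decrease := (model Rt g y 0 - model Rt g y s).
Hypotheses (L1_ge0 : 0 <= L1) (L2_ge0 : 0 <= L2) (gam_gt0 : 0 < gam) (eta01 : 0 < eta
  < 1).
Hypothesis rd : radius_direction Rt g y gam lam delta u.
Hypothesis cs : cauchy_step Rt g y delta u t.
Hypothesis s_delta : rnorm y s <= delta.
Hypothesis s_cauchy : model Rt g y s <= model Rt g y (t *: u).
Hypothesis op : (opnorm y H <= L1%:E)%E.
Hypothesis first_order : `|g (Rt y s) - g y - metric y s (grad g y)| <= L1 / 2 *
  rnorm y s ^+ 2.
Hypothesis second_order :
  `|g (Rt y s) - g y - metric y s (grad g y) - 2^-1 * metric y s (H s)| <= L2 / 6 *
    rnorm y s ^+ 3.

Lemma modelE v : model Rt g y v = g y + metric y v (grad g y) + 2^-1 * metric y v (H v).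
Proof. by rewrite /model (gradT_pullback Rt_retraction g_C2). Qed.

Lemma model0 : model Rt g y 0 = g y.
Proof. by rewrite modelE !metric0l mulr0 !addr0. Qed.

Lemma hess_pullback_bound v : rnorm y (H v) <= L1 * rnorm y v.
Proof.
have [v0|v0] := eqVneq (rnorm y v) 0.
  by rewrite v0 mulr0 (rnorm_eq0 v0) (hess_pullback0 Rt_retraction g_C2) /rnorm
    metric0l sqrtr0.
have vp : 0 < rnorm y v by rewrite lt_def v0 rnorm_ge0.
rewrite mulrC -ler_pdivrMl// -lee_fin; apply: le_trans op; apply: ereal_sup_ubound.
exists ((rnorm y v)^-1 *: v) => /=.
  by rewrite rnormZ ger0_norm ?invr_ge0 ?rnorm_ge0// mulVf.
by rewrite (hess_pullbackZ Rt_retraction g_C2) rnormZ ger0_norm// invr_ge0 ltW.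
Qed.

Lemma hess_quad_bound v : `|metric y v (H v)| <= L1 * rnorm y v ^+ 2.
Proof.
apply: le_trans (metric_le_rnorm _ _ _) _.
by rewrite expr2 mulrCA ler_wpM2l ?rnorm_ge0// hess_pullback_bound.
Qed.

(* Unification otherwise unfolds these down to the real numbers. *)
Local Opaque model hess_pullback rnorm grad.

(** Compare the Cauchy step with the full step of length [delta] along the unit eigenvector: its
    linear term is nonpositive and its quadratic term is [lam * delta ^+ 2 / 2]. *)
Lemma decrease_curvature : curvature_step -> gam ^+ 2 * Lam ^+ 3 / 2 <= decrease.
Proof.
move=> c; move: rd; rewrite /radius_direction c => -[dE [_ Hu] u1 ug].
have /andP[lam0 _] := c; have LE : Lam = - lam.
  by rewrite /negpart min_l ?ltW// ltr0_norm.
have d0 : 0 <= delta by rewrite dE mulr_ge0// ltW.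
have [_ _ /(_ delta d0)] := cs; rewrite rnormZ u1 mulr1 ger0_norm// => /(_ (lexx _)) ct.
rewrite model0 lerBrDl -lerBrDr; apply: le_trans s_cauchy _; apply: le_trans ct _.
rewrite modelE (hess_pullbackZ Rt_retraction g_C2) Hu !metricZl !metricZr -rnorm_sqr
  u1 expr1n mulr1.
rewrite dE LE; have : gam * - lam * metric y u (grad g y) <= 0.
  by rewrite mulr_ge0_le0// mulr_ge0 ?ltW// oppr_gt0.
by move: (metric _ _ _) => m; nra.
Qed.

(** Compare the Cauchy step with [tau *: u], whose quadratic term costs at most half of the linear
    gain. The acceptance test takes [tau] to be [gam], the decrease estimate a lower bound [gm] of
    it. *)
Lemma decrease_gradient tau : ~~ curvature_step -> 0 <= tau <= gam -> tau * L1 <= 1 ->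
  tau / 2 * N ^+ 2 <= decrease.
Proof.
move=> c /andP[tau0 taug] tL; move: rd;
  rewrite /radius_direction (negbTE c) => -[dE uE].
have rn : rnorm y (tau *: u) = tau * N by rewrite uE scalerN rnormN rnormZ ger0_norm.
have [_ _ /(_ tau tau0)] := cs; rewrite rn dE ler_wpM2r ?rnorm_ge0// => /(_ isT) ct.
rewrite model0 lerBrDl -lerBrDr; apply: le_trans s_cauchy _; apply: le_trans ct _.
rewrite uE scalerN -scaleNr modelE (hess_pullbackZ Rt_retraction g_C2) !metricZl
  !metricZr -rnorm_sqr.
have := hess_quad_bound (grad g y); rewrite ler_norml => /andP[_].
set q := metric _ _ _; set N2 := N ^+ 2 => qb.
have N20 : 0 <= N2 by rewrite sqr_ge0.
have : tau * (tau * q) <= tau * N2.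
  rewrite ler_wpM2l//; apply: le_trans (_ : tau * (L1 * N2) <= _);
    first by rewrite ler_wpM2l.
  by rewrite mulrA ler_piMl.
lra.
Qed.

Lemma curvature_le_gradient : ~~ curvature_step -> Lam ^+ 3 <= N ^+ 2.
Proof.
rewrite negb_and -leNgt -leNgt => /orP[lam0|//].
by rewrite /negpart min_r// normr0 expr0n/= sqr_ge0.
Qed.

(** It suffices that the model error at [s] is at most [1 - eta] times the model decrease. The error
    is bounded through [second_order] after a curvature step, and through [first_order] with the
    Hessian bound after a gradient step. *)
Lemma successful : 2 * L1 * gam <= 1 - eta -> L2 * gam <= 3 * (1 - eta) ->
  eta <= rho Rt g y s.
Proof.
have /andP[e0 e1] := eta01.
move=> h1 h2.
have ratio_arith (a b c : R) : c - b <= (1 - eta) * (a - b) -> eta * (a - b) <= a - c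
  by lra.
have second_arith (a b c d z : R) : a - b - c - 2^-1 * d <= z -> a - (b + c + 2^-1 *
  d) <= z by lra.
have first_arith (a b c d z : R) : a - b - c <= L1 / 2 * z -> - (L1 * z) <= d ->
  a - (b + c + 2^-1 * d) <= L1 * z by lra.
have h2' : L2 * gam / 3 <= 1 - eta by move: h2; lra.
have gL : gam * L1 <= 1 by move: h1 e0; lra.
rewrite /rho; case: eqVneq => [_|den0]; first exact: ltW.
have s0 := rnorm_ge0 y s.
suff [dge gap] : 0 <= decrease /\ g (Rt y s) - model Rt g y s <= (1 - eta) * decrease.
  have dgt : 0 < decrease by rewrite lt_def den0.
  rewrite ler_pdivlMr//; move: gap; rewrite model0.
  exact: ratio_arith.
case: (boolP curvature_step) => c.
  have D := decrease_curvature c; have D0 : 0 <= decrease by apply: le_trans D;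
    rewrite !mulr_ge0 ?invr_ge0 ?exprn_ge0// ltW.
  split; first exact: D0.
  have := second_order; rewrite ler_norml => /andP[_ so].
  apply: (@le_trans _ _ (L2 / 6 * rnorm y s ^+ 3)); first by rewrite (modelE s);
    exact: second_arith so.
  move: rd; rewrite /radius_direction c => -[dE _ _ _].
  have : rnorm y s ^+ 3 <= (gam * Lam) ^+ 3 by rewrite -dE lerXn2r ?nnegrE//
    (le_trans s0).
  rewrite exprMn => s3.
  apply: (@le_trans _ _ (L2 / 6 * (gam ^+ 3 * Lam ^+ 3)));
    first by rewrite ler_wpM2l// divr_ge0.
  (* The first factor is at most [1 - eta] by [h2'], the second at most the model decrease by
     [D]. *)
  have -> : L2 / 6 * (gam ^+ 3 * Lam ^+ 3) = (L2 * gam / 3) * (gam ^+ 2 * Lam ^+ 3 /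
    2) by field.
  by rewrite ler_pM// ?mulr_ge0 ?invr_ge0 ?exprn_ge0// ltW.
have D : gam / 2 * N ^+ 2 <= decrease.
  by apply: decrease_gradient => //; rewrite lexx andbT ltW.
have D0 : 0 <= decrease by apply: le_trans D;
  rewrite mulr_ge0 ?sqr_ge0// divr_ge0// ltW.
split; first exact: D0.
have := first_order; rewrite ler_norml => /andP[_ fo].
have := hess_quad_bound s; rewrite ler_norml => /andP[qb _].
apply: (@le_trans _ _ (L1 * rnorm y s ^+ 2)); first by rewrite (modelE s);
  exact: first_arith fo qb.
move: rd; rewrite /radius_direction (negbTE c) => -[dE _].
have : rnorm y s ^+ 2 <= (gam * N) ^+ 2 by rewrite -dE lerXn2r ?nnegrE// (le_trans s0).
rewrite exprMn => s2.
apply: (@le_trans _ _ (L1 * (gam ^+ 2 * N ^+ 2))); first by rewrite ler_wpM2l.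
have -> : L1 * (gam ^+ 2 * N ^+ 2) = (2 * L1 * gam) * (gam / 2 * N ^+ 2) by field.
apply: ler_pM => //; first by apply: mulr_ge0; [exact: mulr_ge0|exact: ltW].
by rewrite mulr_ge0 ?sqr_ge0// divr_ge0// ltW.
Qed.

(** The branch test selects the larger of the two terms. The common constant comes from
    [gm ^+ 2 <= gam ^+ 2] for a curvature step and from [gm ^+ 2 <= gm] for a gradient step. *)
Lemma successful_decrease gm : 0 < gm <= gam -> gm < 1 -> gm * L1 <= 1 ->
  eta <= rho Rt g y s ->
  2^-1 * eta * gm ^+ 2 * Num.max (N ^+ 2) (Lam ^+ 3) <= g y - g (Rt y s).
Proof.
have /andP[e0 e1] := eta01.
move=> /andP[gm0 gmg] gm1 gL.
have gm2 : gm ^+ 2 <= gam ^+ 2 by rewrite lerXn2r// nnegrE ltW.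
have N0 := rnorm_ge0 y (grad g y).
have D : gm ^+ 2 / 2 * Num.max (N ^+ 2) (Lam ^+ 3) <= decrease.
  case: (boolP curvature_step) => c.
    have /andP[_ /ltW NL] := c; rewrite max_r//.
    apply: le_trans (decrease_curvature c).
    by rewrite mulrAC ler_wpM2r// ler_wpM2r// exprn_ge0.
  rewrite max_l; last exact: curvature_le_gradient.
  apply: le_trans (decrease_gradient c _ gL); last by rewrite ltW.
  by rewrite ler_wpM2r ?sqr_ge0// ler_wpM2r// expr2 ler_piMl// ltW.
(* A zero denominator gives ratio 1 by convention, hence acceptance. Then [N] and [Lam] vanish, so
   do [delta] and [s], and both sides are 0. *)
rewrite /rho; case: eqVneq => [d0 _|dn0].
  have X0 : Num.max (N ^+ 2) (Lam ^+ 3) <= 0.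
    by rewrite -(@pmulr_rle0 _ (gm ^+ 2 / 2)) ?divr_gt0 ?exprn_gt0//; rewrite -d0.
  move: X0; rewrite ge_max => /andP[N20 L30].
  have NN : N = 0 by apply/eqP; rewrite -sqrf_eq0 eq_le N20 sqr_ge0.
  have LL : Lam = 0.
    have : Lam ^+ 3 == 0 by rewrite eq_le L30 exprn_ge0.
    by rewrite expf_eq0 => /eqP.
  have dz : delta = 0.
    by move: rd; rewrite /radius_direction; case: ifP => _ [-> *];
      rewrite ?NN ?LL mulr0.
  have sz : s = 0 by apply: (@rnorm_eq0 _ _ _ y); apply/eqP;
    rewrite eq_le rnorm_ge0 -{1}dz s_delta.
  by rewrite sz (retraction0 Rt_retraction) subrr NN LL !expr0n/= maxxx mulr0.
have dp : 0 < decrease.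
  rewrite lt_def dn0; apply: le_trans D.
  by apply: mulr_ge0; [rewrite divr_ge0// sqr_ge0|rewrite le_max sqr_ge0].
rewrite ler_pdivlMr//; apply: le_trans.
have -> : 2^-1 * eta * gm ^+ 2 * Num.max (N ^+ 2) (Lam ^+ 3) = eta * (gm ^+ 2 / 2 *
  Num.max (N ^+ 2) (Lam ^+ 3)) by ring.
by rewrite ler_wpM2l// ltW.
Qed.

End TrustRegionStep.

(** * Limits of almost critical points *)

Section Cluster.
Variables (R : realType) (n : nat) (M : riemannian_manifold R n).
Variables (Rt : M -> 'rV[R]_n -> M) (Rt_retraction : retraction Rt).
Variables (g : M -> R) (g_C2 : C2_function g).

Lemma derive_comp_linear (V V' W : normedModType R) (T : {linear V -> V'})
    (f : V' -> W) (x v : V) : 'D_v (f \o T) x = 'D_(T v) f (T x).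
Proof.
rewrite /derive; set p := (X in lim (X @ _) = _); set q := (X in _ = lim (X @ _)).
by suff -> : p = q by []; rewrite funeqE => h; rewrite /p /q /= (linearD T) linearZZ.
Qed.

Lemma eq_derive2 (V W : normedModType R) (U : set V) (f h : V -> W) (x v : V) :
  open U -> U x -> (forall z, U z -> f z = h z) -> 'D_v ('D_v f) x = 'D_v ('D_v h) x.
Proof.
move=> oU Ux fh; apply: near_eq_derive; near=> z; apply: near_eq_derive.
have : U z by near: z; exact: open_nbhs_nbhs.
by move=> Uz; near=> z'; apply: fh; near: z'; exact: open_nbhs_nbhs.
Unshelve. all: by end_near. Qed.

Lemma ge0_frequently (T : topologicalType) (p : T) (f : T -> R) :
  {for p, continuous f} ->
  (forall A, nbhs p A -> exists2 q, A q & 0 <= f q) -> 0 <= f p.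
Proof.
move=> cf fr; rewrite leNgt; apply/negP => fp.
have [q /= fq] := fr _ (cvgr_lt _ cf _ fp).
by rewrite leNgt fq.
Qed.

Lemma ge0_of_perturbation (a m : R) : 0 <= m ->
  (forall eps, 0 < eps -> 0 <= a + eps * m) -> 0 <= a.
Proof.
move=> m0 am; rewrite leNgt; apply/negP => a0.
(* With this [e], [e * (m + 1) = - a / 2], so [a + e * m] is negative; [m + 1] keeps the denominator
   positive. *)
have e0 : 0 < - a / (2 * (m + 1)) by rewrite divr_gt0 ?oppr_gt0// mulr_gt0// ltr_wpDl.
have := am _ e0; set e := _ / _ in e0 *.
have eE : e * (m + 1) = - a / 2 by rewrite /e; field; rewrite gt_eqF// ltr_wpDl.
by move: eE e0; rewrite mulrDr mulr1; lra.
Qed.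

(** * Fibre derivatives of the pullback in a fixed chart *)

Section AtPoint.
Variables (c : chart R n M) (ac : atlas c).
Local Notation G := (g \o retr_chart Rt c).
Local Notation T q := (tangent_of c q).
Local Notation D w q := ('D_((0 : 'rV[R]_n), w) G (cphi c q, (0 : 'rV[R]_n))).
Local Notation DD w q :=
  ('D_((0 : 'rV[R]_n), w) ('D_((0 : 'rV[R]_n), w) G) (cphi c q, (0 : 'rV[R]_n))).

Lemma slice_retr_chart q : cdom c q ->
  (fun v => G (cphi c q, v)) = pullback Rt g q \o T q.
Proof. by move=> qc; rewrite funeqE => v; rewrite /= /retr_chart/= cphiK. Qed.

(** The right-hand side is expressed through [chart_at q], which may jump with [q]; the left-hand
    side lives in the fixed chart [c], which gives its continuity in [q]. [derive2_retr_chart] does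
    the same at second order. *)
Lemma derive_retr_chart q w : cdom c q -> D w q = metric q (grad g q) (T q w).
Proof.
move=> qc; rewrite -derive_slice slice_retr_chart// derive_comp_linear.
by rewrite linear0; exact: derive_pullback.
Qed.

Lemma derive2_retr_chart q w : cdom c q ->
  DD w q = metric q (hess_pullback Rt g q (T q w)) (T q w).
Proof.
move=> qc; rewrite -(@derive_slice _ _ _ _ ('D_(0, w) G)).
have -> : (fun v => 'D_(0, w) G (cphi c q, v)) = ('D_(T q w) (pullback Rt g q)) \o T q.
  rewrite funeqE => v; rewrite -derive_slice slice_retr_chart//.
  exact: derive_comp_linear.
rewrite derive_comp_linear linear0; apply: esym; exact: metric_hess_pullback.
Qed.

(** Writing [cpsi c (cphi c q)] for [q] makes the function factor through the coordinates in which
    [metric_smooth] is stated. *)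
Lemma metric_tangent_continuous p w : cdom c p ->
  {for p, continuous (fun q => metric (cpsi c (cphi c q))
    (tangent_of c (cpsi c (cphi c q)) w) (tangent_of c (cpsi c (cphi c q)) w) : R)}.
Proof.
move=> pc; apply: (@continuous_comp _ _ _ (cphi c) (fun x => metric (cpsi c x)
      (tangent_of c (cpsi c x) w) (tangent_of c (cpsi c x) w) : R)).
  exact: cphi_continuous.
by apply: (metric_smooth ac w w 0%N); exact: cphi_img.
Qed.

Lemma retr_dom_center p : cdom c p -> retr_dom Rt c c (cphi c p, 0).
Proof.
move=> pc; split => /=; first exact: cphi_img.
by rewrite /retr_chart /= cphiK// [tangent_of _ _ _]linear0 retraction0.
Qed.

Lemma pair0_continuous p : cdom c p ->
  {for p, continuous (fun q => (cphi c q, (0 : 'rV[R]_n)))}.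
Proof.
move=> pc; have cc : cphi c q @[q --> p] --> cphi c p by exact: cphi_continuous.
have c0 : cst (0 : 'rV[R]_n) q @[q --> p] --> (0 : 'rV[R]_n) by exact: cvg_cst.
exact: (cvg_pair cc c0).
Qed.

Lemma derive_retr_chart_continuous p w : cdom c p -> {for p, continuous (fun q => D w
  q)}.
Proof.
move=> pc; have [_ C] := comp_retr_chart_C2 Rt_retraction g_C2 ac ac.
apply: (@continuous_comp _ _ _ (fun q => (cphi c q, (0 : 'rV[R]_n))) ('D_(0, w) G)).
  exact: pair0_continuous.
have [dG _] := C (0, w); apply: differentiable_continuous; apply: dG.
exact: retr_dom_center.
Qed.

Lemma derive2_retr_chart_continuous p w : cdom c p -> {for p, continuous (fun q => DD
  w q)}.
Proof.
move=> pc; have [_ C] := comp_retr_chart_C2 Rt_retraction g_C2 ac ac.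
apply: (@continuous_comp _ _ _ (fun q => (cphi c q, (0 : 'rV[R]_n))) ('D_(0, w)
  ('D_(0, w) G))).
  exact: pair0_continuous.
have [_ CG] := C (0, w); apply: (CG (0, w)).
exact: retr_dom_center.
Qed.

End AtPoint.

(** Since [p] is critical, the second derivative of [g] along a curve through [p] is the coordinate
    Hessian [Q] at the velocity. The retraction realizes every velocity, so [Q] is nonnegative
    because the Hessian of the pullback is. *)
Lemma two_critical_pullback p :
  (forall w, 'D_w (pullback Rt g p) 0 = 0) ->
  (forall w, 0 <= 'D_w ('D_w (pullback Rt g p)) 0) -> two_critical g p.
Proof.
set c := chart_at p; have ac : atlas c := chart_at_atlas p;
  have pc : cdom c p := chart_at_dom p.
move=> D0 DD0; pose h := g \o cpsi c.
have Ch := g_C2 ac; have [dh _] := Ch.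
have h0 w : 'D_w h (cphi c p) = 0.
  rewrite deriveE; last by apply: dh; exact: cphi_img.
  have [U [oU U0 _ _ [dp _]]] := retraction_at_C2 Rt_retraction g_C2 p.
  apply: etrans (esym (diff_pullback Rt_retraction g_C2 p w)) _.
  by rewrite -(D0 w); apply: esym; exact: (deriveE w (dp 0 U0)).
pose Q v := \sum_i \sum_j (v : 'rV[R]_n) 0 i * v 0 j *
  'D_(delta_mx 0 j) ('D_(delta_mx 0 i) h) (cphi c p).
have Q0 w : 0 <= Q w.
  have [U [oU U0 CF Uc _]] := retraction_at_C2 Rt_retraction g_C2 p.
  have F0 : (cphi c \o Rt p) 0 = cphi c p by rewrite /= retraction0.
  suff -> : Q w = 'D_w ('D_w (pullback Rt g p)) 0 by exact: DD0.
  have -> : 'D_w ('D_w (pullback Rt g p)) 0 = 'D_w ('D_w (h \o (cphi c \o Rt p))) 0.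
    by apply: (@eq_derive2 _ _ U) => // z Uz; rewrite /pullback /= /h /= cphiK//;
      exact: Uc.
  rewrite (@derive2_comp_critical _ _ _ U (cimg c)) ?F0//.
    by rewrite derive_retraction.
  by move=> z Uz; apply: cphi_img; exact: Uc.
move=> cu scu cu0; have [] := scu c ac; rewrite setTI => oU Ccu.
have U0 : (cu @^-1` cdom c) 0 by rewrite /= cu0.
have gE z : (cu @^-1` cdom c) z -> (g \o cu) z = (h \o (cphi c \o cu)) z.
  by move=> zc; rewrite /= /h /= cphiK.
have F0 : (cphi c \o cu) 0 = cphi c p by rewrite /= cu0.
have [dF _] := Ccu 2%N.
split.
  rewrite derive1E (near_eq_derive (g := h \o (cphi c \o cu))).
    rewrite derive_chain; [|exact: (dF 0 U0)|by rewrite F0; apply: dh; exact: cphi_img].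
    by apply: big1 => i _; rewrite F0 h0 mulr0.
  by near=> z; apply: gE; near: z; exact: open_nbhs_nbhs.
have d1 (f : R -> R) : derive1 f = 'D_1 f by apply/funext => z; rewrite derive1E.
rewrite -[derive1n 2 _ _]/(derive1 (derive1 (g \o cu)) 0) !d1.
rewrite (eq_derive2 _ oU U0 gE).
rewrite (@derive2_comp_critical _ _ _ _ (cimg c) _ _ _ _ oU U0 _ (Ccu 2%N) Ch) ?F0//.
  exact: Q0.
by move=> z zc; exact: cphi_img.
Unshelve. all: by end_near. Qed.

(** For [w] fixed in the chart at [p], each condition holds at [q] up to the error [eps * m w q],
    with [m w] continuous. First [q] tends to [p] for fixed [eps], then [eps] tends to 0. *)
Lemma two_critical_limit p :
  (forall A eps, nbhs p A -> 0 < eps -> exists q lam,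
     [/\ A q, rnorm q (grad g q) <= eps, least_eigenvalue (hess_pullback Rt g q) lam
       & - eps <= lam]) ->
  two_critical g p.
Proof.
move=> near_critical; set c := chart_at p; have ac : atlas c := chart_at_atlas p.
have pc : cdom c p := chart_at_dom p.
have nc : nbhs p (cdom c) by apply: open_nbhs_nbhs; split => //; exact: cdom_open.
pose m w q := metric (cpsi c (cphi c q))
  (tangent_of c (cpsi c (cphi c q)) w) (tangent_of c (cpsi c (cphi c q)) w).
have mE w q : cdom c q -> m w q = metric q (tangent_of c q w) (tangent_of c q w).
  by move=> qc; rewrite /m cphiK.
have m0 w q : 0 <= m w q by exact: metric_ge0.
have cm w : {for p, continuous (m w)} by exact: metric_tangent_continuous.
have cst_mul (eps : R) (f : M -> R) : {for p, continuous f} -> {for p, continuous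
  (fun q => eps * f q)}.
  by move=> cf; apply: (@continuousM _ _ (cst eps) f) => //; exact: cst_continuous.
apply: two_critical_pullback => w.
  pose a q := 'D_((0 : 'rV[R]_n), w) (g \o retr_chart Rt c) (cphi c q, (0 : 'rV[R]_n)).
  have aE q : cdom c q -> a q = metric q (grad g q) (tangent_of c q w) by exact:
    derive_retr_chart.
  have ca : {for p, continuous a} by exact: derive_retr_chart_continuous.
  (* The equation [a p = 0] is recast as an inequality so that it passes to the limit like the
     second-order condition. *)
  suff : 0 <= - (a p * a p).
    rewrite oppr_ge0 -expr2 => a2; have : a p = 0 by apply/eqP;
      rewrite -sqrf_eq0 eq_le a2 sqr_ge0.
    by rewrite aE// tangent_of_chart_at (derive_pullback Rt_retraction g_C2).
  apply: (ge0_of_perturbation (m0 w p)) => eps eps0.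
  apply: (@ge0_frequently _ p (fun q => - (a q * a q) + eps * m w q)).
    apply: (@continuousD _ _ _ (fun q => - (a q * a q)) (fun q => eps * m w q)).
      by apply: (@continuousN _ _ _ (fun q => a q * a q));
        exact: (@continuousM _ _ a a).
    exact: cst_mul.
  (* Cauchy-Schwarz bounds the square of [a q] by [e ^+ 2 * m w q], and [e <= 1] gives
     [e ^+ 2 <= eps]. *)
  move=> A pA; pose e := Num.min eps 1.
  have e0 : 0 < e by rewrite lt_min eps0 ltr01.
  have [q [lam [[Aq qc] qe _ _]]] := near_critical _ e (filterI pA nc) e0.
  exists q => //; rewrite aE// mE// addrC subr_ge0 -expr2 -[leLHS]real_normK
    ?num_real//.
  apply: (@le_trans _ _ ((rnorm q (grad g q) * rnorm q (tangent_of c q w)) ^+ 2)).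
    by rewrite lerXn2r ?nnegrE// ?mulr_ge0 ?rnorm_ge0// metric_le_rnorm.
  rewrite exprMn (rnorm_sqr q (tangent_of c q w)) ler_wpM2r ?metric_ge0//.
  apply: (@le_trans _ _ e); last by rewrite ge_min lexx.
  rewrite expr2 -[leRHS]mulr1; apply: ler_pM; rewrite ?rnorm_ge0//.
  by apply: le_trans qe _; rewrite ge_min lexx orbT.
pose b q := 'D_((0 : 'rV[R]_n), w) ('D_((0 : 'rV[R]_n), w) (g \o retr_chart Rt c))
  (cphi c q, (0 : 'rV[R]_n)).
have bE q : cdom c q -> b q = metric q (hess_pullback Rt g q (tangent_of c q w))
  (tangent_of c q w).
  exact: derive2_retr_chart.
have cb : {for p, continuous b} by exact: derive2_retr_chart_continuous.
suff : 0 <= b p.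
  by rewrite bE// tangent_of_chart_at (metric_hess_pullback Rt_retraction g_C2).
apply: (ge0_of_perturbation (m0 w p)) => eps eps0.
apply: (@ge0_frequently _ p (fun q => b q + eps * m w q)).
  by apply: (@continuousD _ _ _ b (fun q => eps * m w q)) => //; exact: cst_mul.
move=> A pA; have [q [lam [[Aq qc] _ lamq le_lam]]] := near_critical _ eps (filterI
  pA nc) eps0.
exists q => //; rewrite bE// mE//; set v := tangent_of c q w.
have := @rayleigh_ge _ _ _ q (hess_pullback Rt g q) lam v (hess_pullback_linear
  Rt_retraction g_C2 q)
  (hess_pullback_sym Rt_retraction g_C2 q) lamq.
rewrite [X in 0 <= X + _]Defs.metric_sym -lerBlDr sub0r -mulNr; apply: le_trans.
by rewrite ler_wpM2r ?metric_ge0.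
Qed.

End Cluster.

(** * Runs of the algorithm *)

Local Opaque model hess_pullback rnorm grad rho.

Section Run.
Variables (R : realType) (n : nat) (M : riemannian_manifold R n).
Variables (Rt : M -> 'rV[R]_n -> M) (Rt_retraction : retraction Rt).
Variables (g : M -> R) (g_C2 : C2_function g).
Variables (Phi : M -> M) (gamc eta gamlo gamhi : R).
Hypotheses (gamc01 : 0 < gamc < 1) (eta01 : 0 < eta < 1).
Hypotheses (gamlo_gt0 : 0 < gamlo) (gamlo_hi : gamlo <= gamhi).
Variables (yin : M) (y : nat -> M) (gam lam delta t : nat -> R) (u s : nat -> 'rV[R]_n).
Hypothesis run : htr_run Rt g Phi gamc eta gamlo gamhi yin y gam lam delta t u s.
Hypothesis A1 : forall x : M, g (Phi x) <= g x.
Variables (L1 L2 : R).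
Hypotheses (L1_ge0 : 0 <= L1) (L2_ge0 : 0 <= L2).
Hypothesis A2_opnorm : forall k, (opnorm (y k) (hess_pullback Rt g (y k)) <= L1%:E)%E.
Hypothesis A2_first : forall k,
  `|g (Rt (y k) (s k)) - g (y k) - metric (y k) (s k) (grad g (y k))|
    <= L1 / 2 * rnorm (y k) (s k) ^+ 2.
Hypothesis A2_second : forall k,
  `|g (Rt (y k) (s k)) - g (y k) - metric (y k) (s k) (grad g (y k))
     - 2^-1 * metric (y k) (s k) (hess_pullback Rt g (y k) (s k))|
    <= L2 / 6 * rnorm (y k) (s k) ^+ 3.
Variable gmin : R.
Hypothesis A3 : forall k, gmin <= g (y k).

Local Notation gm := (gamma_min gamc eta gamlo L1 L2).
Local Notation kappa := (kappa_min gamc eta gamlo L1 L2).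
Let success k : bool := eta <= rho Rt g (y k) (s k).
Let gradnorm k := rnorm (y k) (grad g (y k)).
Let curv k := `|negpart (lam k)|.

Let gmP := gamma_min_spec gamc01 eta01 gamlo_gt0 L1_ge0 L2_ge0.

Lemma run_failure k : ~~ success k ->
  [/\ y k.+1 = y k, gam k.+1 = gamc * gam k & lam k.+1 = lam k].
Proof.
move=> nk; have := htr_update run k; rewrite -/(success k) (negbTE nk) => -[yk gk];
  split=> //.
(* Two least eigenvalues of the same operator bound each other. *)
have [[v ev] lmin] := htr_lam run k; have [[v' ev'] lmin'] := htr_lam run k.+1.
by move: ev' lmin'; rewrite yk => /lmin le1 /(_ _ _ ev) le2; apply/eqP;
  rewrite eq_le le1 le2.
Qed.

Lemma run_success k : success k ->
  y k.+1 = Phi (Rt (y k) (s k)) /\ gamlo <= gam k.+1 <= gamhi.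
Proof. by move=> sk; have := htr_update run k; rewrite -/(success k) sk. Qed.

(** If a failure brought the radius parameter below [gm], then [gam k] would be below [gm / gamc],
    where [successful] forces acceptance. This is the origin of the factors [gamc] in
    [gamma_min]. *)
Lemma gam_ge_gamma_min k : gm <= gam k.
Proof.
have [gm0 gmlo gmL gm1 gm2] := gmP; have /andP[gc0 _] := gamc01.
elim: k => [|k IH]; first by case/andP: (htr_gam0 run) => + _; exact: le_trans.
case: (boolP (success k)) => sk.
  by have [_ /andP[+ _]] := run_success sk; exact: le_trans.
have [_ -> _] := run_failure sk; have gk0 : 0 < gam k by exact: lt_le_trans IH.
rewrite leNgt; apply/negP => gt; move/negP: sk; apply.
have [sd sc] := htr_step run k.
have rd := htr_radius_direction run k; have cs := htr_cauchy run k.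
apply: (successful Rt_retraction g_C2 L1_ge0 L2_ge0 gk0 eta01 rd cs sd sc (A2_opnorm k)
  (A2_first k) (A2_second k)).
- have : gamc * gam k * (2 * L1) <= gamc * (1 - eta).
    by apply: le_trans gm1; rewrite ler_wpM2r ?mulr_ge0// ltW.
  by rewrite -mulrA (ler_pM2l gc0) mulrC.
- have : gamc * gam k * L2 <= gamc * (3 * (1 - eta)).
    by rewrite mulrA [gamc * 3]mulrC; apply: le_trans gm2; rewrite ler_wpM2r// ltW.
  by rewrite -mulrA (ler_pM2l gc0) mulrC.
Qed.

Lemma gam_le_fails k : gam k <= gamhi * gamc ^+ fails success k.
Proof.
have /andP[gc0 _] := gamc01.
elim: k => [|k IH]; first by case/andP: (htr_gam0 run); rewrite mulr1.
rewrite /=; case: ifPn => sk.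
  by have [_ /andP[_]] := run_success sk; rewrite mulr1.
by have [_ -> _] := run_failure sk; rewrite exprS mulrCA ler_pM2l.
Qed.

(** Take logarithms in [gm <= gamhi * gamc ^+ j]; dividing by the negative [ln gamc] reverses the
    inequality. The successor on the left, matched by the [+ 1], counts the success closing the
    block. *)
Lemma fails_le_ceil k :
  (fails success k).+1%:Z <= Num.ceil (logb gamc (gm / gamhi) + 1).
Proof.
have [gm0 gmlo _ _ _] := gmP; have /andP[gc0 gc1] := gamc01.
have gh0 : 0 < gamhi by exact: lt_le_trans gamlo_hi.
rewrite -(ler_int R); apply: le_trans (ceil_ge _); set j := fails success k.
rewrite -pmulrn -natr1 lerD2r /logb ler_ndivlMr; last by rewrite ln_lt0// gc0.
rewrite mulr_natl -lnXn// ler_ln ?posrE ?divr_gt0 ?exprn_gt0//.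
by rewrite ler_pdivrMr// mulrC (le_trans (gam_ge_gamma_min k))// gam_le_fails.
Qed.

Lemma fails_lt_ceil k :
  (fails success k < `|Num.ceil (logb gamc (gm / gamhi) + 1)|)%N.
Proof.
by rewrite -lez_nat; apply: le_trans (fails_le_ceil k) _; rewrite abszE ler_norm.
Qed.

Lemma success_decrease k : success k ->
  kappa * Num.max (gradnorm k ^+ 2) (curv k ^+ 3) <= g (y k) - g (y k.+1).
Proof.
move=> sk; have [gm0 _ gmL _ _] := gmP; have /andP[_ gc1] := gamc01.
have [-> _] := run_success sk; have [sd sc] := htr_step run k.
(* The hook can only add to the decrease achieved by the step. *)
apply: le_trans (lerB (lexx _) (A1 _)); rewrite /kappa_min.
have gk := gam_ge_gamma_min k.
have gk0 : 0 < gam k by exact: lt_le_trans gk.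
have rd := htr_radius_direction run k; have cs := htr_cauchy run k.
apply: (successful_decrease Rt_retraction g_C2 gk0 eta01 rd cs sd sc (A2_opnorm k)).
- by rewrite gm0.
- exact: gamma_min_lt1.
- by apply: le_trans (ltW gc1); apply: le_trans gmL; rewrite ler_pM2l// lerDr.
- exact: sk.
Qed.

Lemma kappa_min_gt0 : 0 < kappa.
Proof. by have [gm0 _ _ _ _] := gmP; have /andP[e0 _] := eta01;
  rewrite !mulr_gt0 ?exprn_gt0. Qed.

Lemma value_nonincreasing k : g (y k.+1) <= g (y k).
Proof.
case: (boolP (success k)) => sk; last by have [-> _ _] := run_failure sk.
rewrite -subr_ge0; apply: le_trans (success_decrease sk).
by rewrite mulr_ge0 ?(ltW kappa_min_gt0)// le_max sqr_ge0.
Qed.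

(** * The iteration bound *)

Section Complexity.
Variables (eps1 eps2 : R).
Hypotheses (eps1_gt0 : 0 < eps1) (eps2_gt0 : 0 < eps2).
Let K k := k \in K_set g y lam eps1 eps2.
Local Notation X := (Num.max (1 / eps1 ^+ 2) (1 / eps2 ^+ 3)).

Lemma K_failure k : ~~ success k -> K k.+1 = K k.
Proof.
move=> sk; have [yk _ lk] := run_failure sk.
by apply/idP/idP => /set_mem h; apply/mem_set; move: h; rewrite /K_set /= yk lk.
Qed.

Lemma K_success_decrease k : success k -> K k -> kappa <= (g (y k) - g (y k.+1)) * X.
Proof.
move=> sk /set_mem Kk; have k0 := kappa_min_gt0.
have X0 : 0 < X by rewrite lt_max divr_gt0 ?exprn_gt0.
apply: le_trans (_ : kappa * Num.max (gradnorm k ^+ 2) (curv k ^+ 3) * X <= _);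
  last first.
  by rewrite ler_wpM2r ?success_decrease// ltW.
(* For [k] in [K] one of the two quantities exceeds its threshold, so its product with [X] is at
   least 1. *)
have one_le (a m x : R) : 0 < a -> a <= m -> 1 / a <= x -> 1 <= m * x.
  move=> a0 am ax; rewrite -(divff (lt0r_neq0 a0)) -[a / a]mulr1 -mulrA [_ * 1]mulrC.
  by apply: ler_pM => //; rewrite ?divr_ge0 ?ltW.
rewrite -mulrA ler_peMr ?(ltW k0)//; case: Kk => [gk|ck].
  apply: (one_le (eps1 ^+ 2)); rewrite ?exprn_gt0// le_max ?lexx//.
  by rewrite lerXn2r ?nnegrE ?rnorm_ge0// ltW.
apply: (one_le (eps2 ^+ 3)); rewrite ?exprn_gt0// le_max ?lexx ?orbT//.
by apply/orP; right; rewrite lerXn2r ?nnegrE /curv// ltW.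
Qed.

(** Telescoping sum: successes in [K] contribute at least [kappa] each, all other iterations a
    nonnegative amount. *)
Lemma count_K_success N :
  (count (predI success K) (iota 0 N))%:R * kappa <= (g (y 0%N) - g (y N)) * X.
Proof.
have X0 : 0 <= X by rewrite le_max divr_ge0// exprn_ge0// ltW.
elim: N => [|N IH]; first by rewrite mul0r subrr mul0r.
rewrite count_iotaS natrD mulrDl.
have -> : g (y 0%N) - g (y N.+1) = (g (y 0%N) - g (y N)) + (g (y N) - g (y N.+1)) by
  ring.
rewrite mulrDl; apply: lerD => //; rewrite -[predI _ _ _]/(success N && K N).
case: (boolP (success N && K N)) => [/andP[sN KN]|_].
  by rewrite [leLHS]mul1r; exact: K_success_decrease.
by rewrite [leLHS]mul0r mulr_ge0// subr_ge0 value_nonincreasing.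
Qed.

Lemma complexity : finite_set (K_set g y lam eps1 eps2) /\
  ((#|` fset_set (K_set g y lam eps1 eps2)|%fset)%:Z <=
   Num.ceil (logb gamc (gm / gamhi) + 1) *
   Num.floor ((g (y 0%N) - gmin) / kappa * X)).
Proof.
set C := Num.ceil _; set F := Num.floor _.
have k0 := kappa_min_gt0.
have X0 : 0 <= X by rewrite le_max divr_ge0// exprn_ge0// ltW.
have cF N : ((count (predI success K) (iota 0 N))%:Z <= F).
  rewrite floor_ge_int mulrAC ler_pdivlMr//.
  apply: le_trans (count_K_success N) _.
  by rewrite ler_wpM2r// lerB.
(* Nonnegativity of [F] and [C] lets their absolute values stand for them in the count over natural
   numbers. *)
have F0 : 0 <= F by apply: le_trans (cF 0%N).
have C0 : 0 <= C.
  exact: le_trans (fails_le_ceil 0%N).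
have [] := @count_bounded_finite (K_set g y lam eps1 eps2) (`|C| * `|F|)%N.
  apply: (@count_blocks success K) => [k||N].
  - exact: K_failure.
  - exact: fails_lt_ceil.
  - by rewrite -lez_nat gez0_abs.
move=> fK le; split => //.
by rewrite -(gez0_abs C0) -(gez0_abs F0) -PoszM lez_nat.
Qed.

End Complexity.

(** With both tolerances equal to [eps], [K_set] is finite, so all late iterates are [eps]-critical,
    and some late iterate lies in any given neighbourhood of [p]. *)
Lemma cluster_two_critical p : cluster (y @ \oo) p -> two_critical g p.
Proof.
move=> clp; apply: (two_critical_limit Rt_retraction g_C2) => A eps pA eps0.
have [fK _] := complexity eps0 eps0.
have [N NK] : exists N, forall k, K_set g y lam eps eps k -> (k < N)%N.
  exists (\max_(k <- enum_fset (fset_set (K_set g y lam eps eps))) k).+1 => k Kk;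
    rewrite ltnS.
  apply: (@leq_bigmax_seq _ _ xpredT id) => //.
  by rewrite -[_ \in _]/(k \in fset_set _) in_fset_set// mem_set.
have [_ [[k Nk <-] Ayk]] : (y @` [set k | (N <= k)%N]) `&` A !=set0.
  apply: clp => //; exists N => // k Nk /=; by exists k.
have nK : ~ K_set g y lam eps eps k by move=> /NK; rewrite ltnNge Nk.
exists (y k), (lam k); split=> //; last 2 first.
- exact: (htr_lam run k).
- rewrite leNgt; apply/negP => lk; apply: nK; right.
  have l0 : lam k < 0 by apply: lt_trans lk _; rewrite oppr_lt0.
  by rewrite /negpart min_l ?ltW// ltr0_norm// ltrNr.
by rewrite leNgt; apply/negP => gk; apply: nK; left.
Qed.

End Run.

Unset Implicit Arguments.

Theorem theorem3p4 (R : realType) (n : nat) (M : riemannian_manifold R n)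
    (Rt : M -> 'rV[R]_n -> M) (Rt_retraction : retraction Rt)
    (g : M -> R) (g_C2 : C2_function g)
    (Phi : M -> M) (gamc eta gamlo gamhi : R)
    (gamc01 : 0 < gamc < 1) (eta01 : 0 < eta < 1)
    (gamlo_gt0 : 0 < gamlo) (gamlo_hi : gamlo <= gamhi)
    (yin : M) (y : nat -> M) (gam lam delta t : nat -> R)
    (u s : nat -> 'rV[R]_n)
    (run : htr_run Rt g Phi gamc eta gamlo gamhi yin y gam lam delta t u s)
    (A1 : forall x : M, g (Phi x) <= g x)
    (L1 L2 : R) (L1_ge0 : 0 <= L1) (L2_ge0 : 0 <= L2)
    (A2_opnorm : forall k, (opnorm (y k) (hess_pullback Rt g (y k)) <= L1%:E)%E)
    (A2_first : forall k,
       `|g (Rt (y k) (s k)) - g (y k) - metric (y k) (s k) (grad g (y k))|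
         <= L1 / 2 * rnorm (y k) (s k) ^+ 2)
    (A2_second : forall k,
       `|g (Rt (y k) (s k)) - g (y k) - metric (y k) (s k) (grad g (y k))
          - 2^-1 * metric (y k) (s k) (hess_pullback Rt g (y k) (s k))|
         <= L2 / 6 * rnorm (y k) (s k) ^+ 3)
    (gmin : R) (A3 : forall k, gmin <= g (y k)) :
  [/\ 0 < gamma_min gamc eta gamlo L1 L2 < 1,
      forall eps1 eps2 : R, 0 < eps1 -> 0 < eps2 ->
        finite_set (K_set g y lam eps1 eps2) /\
        ((#|` fset_set (K_set g y lam eps1 eps2)|%fset)%:Z <=
         Num.ceil (logb gamc (gamma_min gamc eta gamlo L1 L2 / gamhi) + 1) *
         Num.floor ((g (y 0%N) - gmin) / kappa_min gamc eta gamlo L1 L2 *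
                    Num.max (1 / eps1 ^+ 2) (1 / eps2 ^+ 3)))
    & forall p : M, cluster (y @ \oo) p -> two_critical g p].
Proof.
have [gm0 _ _ _ _] := gamma_min_spec gamc01 eta01 gamlo_gt0 L1_ge0 L2_ge0.
split=> [|eps1 eps2 eps1_gt0 eps2_gt0|p].
- by rewrite gm0 gamma_min_lt1.
- exact: (complexity Rt_retraction g_C2 gamc01 eta01 gamlo_gt0 gamlo_hi run A1
    L1_ge0 L2_ge0 A2_opnorm A2_first A2_second A3 eps1_gt0 eps2_gt0).
- exact: (cluster_two_critical Rt_retraction g_C2 gamc01 eta01 gamlo_gt0 gamlo_hi run A1
    L1_ge0 L2_ge0 A2_opnorm A2_first A2_second A3).
Qed.
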